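(* (1) Let $q$ be a prime power, $n\ge1$, $a\in\mathbf F_q^\times$, and let $r_d(a)$ denote the number of $d$-th roots of $a$ in $\mathbf F_q^\times$. Then \[ \pi_q(n,(-1)^na)=\frac1n\sum_{d\mid n}\mu(d)r_d(a)\frac{q^{n/d}-1}{q-1}=\frac{q^n-1-\epsilon q^{n/2}}{n(q-1)} \] for some $\epsilon$ with $0\le\epsilon\le10$. (2) Let $q$ be a prime power. Apart from $X\pm1$, all $*$-symmetric monic irreducible polynomials over $\mathbf F_q$ have even degree and constant coefficient $+1$. Their number is given, for $n\ge 1$, by \[ \pi^*_q(2n)=\frac1{2n}\Bigl(\sum_{d\mid n,\ d\text{ odd}}\mu(d)(q^{n/d}-\eta)\Bigr)=\frac{q^n-\epsilon q^{n/3}}{2n} \] for some $\epsilon$ with $0\le\epsilon\le3$, where $\eta=1$ if $q$ is odd and $\eta=0$ if $q$ is even. (3) Let $q$ be a square prime power. All $\dagger$-symmetric monic irreducible polynomials over $\mathbf F_q$ have odd degree and constant coefficient in $U$. Conversely, for any $a\in U$ and $n\ge 1$ we have \[ \pi^\dagger_q(2n-1,-a)=\frac1{2n-1}\sum_{d\mid 2n-1}\mu(d)r_d(a)\frac{q^{(n-1/2)/d}+1}{q^{1/2}+1}=\frac{q^{n-1/2}+1-\epsilon q^{n/3-1/6}}{(2n-1)(q^{1/2}+1)} \] for some $\epsilon$ with $0\le\epsilon\le40$, where here $r_d(a)$ is the number of $d$-th roots of $a$ in $U$.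
   Context: $\mu$ is the M\''obius function on positive integers. For monic $f$ of degree $n$ over $\mathbf F_q$ with $f(0)\ne0$, let $f^*(X)=X^nf(1/X)/f(0)$; $f$ is $*$-symmetric if $f^*=f$. If $q$ is a square, let $\bar x=x^{q^{1/2}}$ for $x\in\mathbf F_q$, let $\bar f$ be $f$ with this map applied to its coefficients, and let $f^\dagger(X)=X^n\bar f(1/X)/\bar f(0)$; $f$ is $\dagger$-symmetric if $f^\dagger=f$. $U\le\mathbf F_q^\times$ is the cyclic subgroup of order $q^{1/2}+1$. $\pi_q(n,a)$ is the number of monic irreducible polynomials of degree $n$ over $\mathbf F_q$ with constant coefficient $a$. $\pi^*_q(n)$ is the number of $*$-symmetric monic irreducible polynomials of degree $n$ over $\mathbf F_q$. $\pi^\dagger_q(n,a)$ is the number of $\dagger$-symmetric monic irreducible polynomials of degree $n$ over $\mathbf F_q$ with constant coefficient $a$. *)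

(* Defs.v *)
From HB Require Import structures.
From mathcomp Require Import all_boot all_order all_algebra all_fingroup.
From mathcomp Require Import all_solvable all_field.
From mathcomp Require Import reals exp.
Set Implicit Arguments.
Unset Strict Implicit.
Unset Printing Implicit Defensive.

Import GRing.Theory.
Local Open Scope ring_scope.

Definition mobius (n : nat) : int :=
  if all (fun p => logn p n == 1%N) (primes n)
  then (-1) ^+ size (primes n) else 0.

Definition nroots (F : finFieldType) (G : {set {unit F}}) (d : nat)
    (a : {unit F}) : nat :=
  #|[set x in G | (x ^+ d == a)%g]|.

(* With n = deg f, the sum is X^n f(1/X) = \sum_i f_i X^(n - i). *)
Definition starpoly (F : fieldType) (f : {poly F}) : {poly F} :=
  (f`_0)^-1 *: \sum_(i < size f) f`_i *: 'X^((size f).-1 - i).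

(* The map x |-> x^s on coefficients; for #|F| = s ^ 2 it is the bar map. *)
Definition barpoly (F : fieldType) (s : nat) (f : {poly F}) : {poly F} :=
  map_poly (fun x => x ^+ s) f.

Definition daggerpoly (F : fieldType) (s : nat) (f : {poly F}) : {poly F} :=
  starpoly (barpoly s f).

(* The condition f(0) != 0 is needed because 0^-1 = 0. *)
Definition star_symmetric (F : fieldType) (f : {poly F}) : bool :=
  (f`_0 != 0) && (starpoly f == f).

Definition dagger_symmetric (F : fieldType) (s : nat) (f : {poly F}) : bool :=
  (f`_0 != 0) && (daggerpoly s f == f).

(* irreducibleb decides irreducible_poly (irreducibleP), and {poly_n.+1 F} is the finite type
   of polynomials of degree at most n. *)
Definition num_irred (F : finFieldType) (n : nat) (P : pred {poly F}) : nat :=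
  #|[set f : {poly_n.+1 F} | [&& size f == n.+1, (f : {poly F}) \is monic,
                                 irreducibleb f & P f]]|.

Definition pi_q (F : finFieldType) (n : nat) (a : F) : nat :=
  num_irred n (fun f => f`_0 == a).

Definition pi_star (F : finFieldType) (n : nat) : nat :=
  num_irred n (@star_symmetric F).

Definition pi_dagger (F : finFieldType) (s n : nat) (a : F) : nat :=
  num_irred n (fun f => dagger_symmetric s f && (f`_0 == a)).

(* Main.v *)
Require Import Defs.
From HB Require Import structures.
From mathcomp Require Import all_boot all_order all_algebra all_fingroup.
From mathcomp Require Import all_solvable all_field.
From mathcomp Require Import reals exp.
From mathcomp Require Import zify ring lra.
Set Implicit Arguments.
Unset Strict Implicit.
Unset Printing Implicit Defensive.
Import Order.TTheory GRing.Theory Num.Theory.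
Local Open Scope ring_scope.

(** Write q for the cardinal of F.  The counts of irreducible polynomials are
    counts of roots.  In the extension L of F of degree n, a monic irreducible
    polynomial of degree n over F has exactly n roots; they form one orbit of the
    Frobenius map x |-> x^q, and every Frobenius orbit of length n arises in this
    way.  Hence n times the number of irreducible polynomials with some property
    is the number of x in L whose orbit has length n and which satisfy the
    corresponding property of roots ([num_irred_fdeg]).

    The properties at hand become equations for a root x of degree n.  The
    constant coefficient is (-1)^n times the norm x^(1 + q + ... + q^(n-1))
    ([coef0_norm]).  A polynomial is star-symmetric when x^-1 is conjugate to x,
    and dagger-symmetric, with q = s^2, when x^(-s) is ([dagger_symmetric_root]).
    Inversion is an involution on the orbit of x, so unless x = 1 or x = -1 the
    length is even, n = 2m, and x^(q^m + 1) = 1 ([inv_conjugate_fdeg]).  The map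
    x |-> x^(-s) is a square root of Frobenius on the orbit, so there the length
    is odd, and x^(s^n + 1) = 1 ([dagger_root_odd]).

    Let A be the set of solutions of such equations in L.  An element of L has
    degree dividing n/d if and only if it is fixed by x |-> x^(q^(n/d)), so the
    elements of A of degree n are counted by Moebius inversion
    ([card_fdeg_mobius]).  The elements of A which are not of degree n are fixed
    by x |-> x^(q^(n/p)) for some prime p dividing n.  So the
    cardinal of A, which is the main term up to a parity term in the star-symmetric
    case, overestimates by a nonnegative amount, which is at most the sum of the
    terms of the prime divisors ([card_fdeg_le], [card_fdeg_ge]); this
    gives the sign of each error term with its size.  The terms themselves come
    from the fact that x^k = u has exactly k solutions in a finite field as soon
    as the cyclic structure of the multiplicative group permits it
    ([card_pow_eq]): the solutions of norm a fixed by x |-> x^(q^(n/d)) have a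
    relative norm which is a d-th root of a, and each fibre of the relative norm
    has the same size ([card_norm_fixed], [card_unitary_norm_fixed]).

    The sums over primes are bounded uniformly in n.  For a prime p >= c dividing
    n one has b^(n/p) <= b^(n/c) * b^(-(p-c)/c), because p <= n
    ([powR_prime_quotient]).  With c = 2 for the first error term and c = 3 for
    the two others, where only odd primes occur, the sum over p becomes an
    arithmetico-geometric series ([prime_sum_bound]). *)

(** * Finite fields: roots and extensions *)

Section PowerMap.

Variables (A : comNzRingType) (e : nat).
Hypothesis pe : [pchar A].-nat e.

(** The power map is made to depend on the characteristic condition so that it
    can be declared as a ring morphism. *)
Definition power_map of [pchar A].-nat e := fun x : A => x ^+ e.

Fact power_map_zmod : zmod_morphism (power_map pe).
Proof.
have e_gt0 : (0 < e)%N by case/andP: pe.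
move=> x y; rewrite /power_map; apply: (addIr (y ^+ e)).
by rewrite -exprDn_pchar // !subrK.
Qed.

Fact power_map_monoid : monoid_morphism (power_map pe).
Proof. by split=> [|x y]; rewrite /power_map ?expr1n ?exprMn. Qed.

HB.instance Definition _ :=
  GRing.isZmodMorphism.Build A A (power_map pe) power_map_zmod.
HB.instance Definition _ :=
  GRing.isMonoidMorphism.Build A A (power_map pe) power_map_monoid.

Lemma power_mapN1 : (-1) ^+ e = -1 :> A.
Proof. exact: (rmorphN1 (power_map pe)). Qed.

End PowerMap.

Lemma pchar_power_inj (K : fieldType) (e : nat) :
  [pchar K].-nat e -> injective (fun x : K => x ^+ e).
Proof. by move=> pe; apply: (fmorph_inj (power_map pe)). Qed.

Lemma pnat_card_finField (F : finFieldType) : [pchar F].-nat #|F|.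
Proof.
have [p p_pr pF] := finPcharP F; rewrite (eq_pnat _ (pcharf_eq pF)).
by have := pprimeChar_pgroup pF; rewrite /pgroup cardsT.
Qed.

(** The polynomial X^#|L| - X is the product of all the X - x, so each of its
    divisors splits into distinct linear factors. *)
Lemma card_roots_dvd_genPoly (L : finFieldType) (p : {poly L}) :
  p %| 'X^#|L| - 'X -> #|[set x | root p x]| = (size p).-1.
Proof.
rewrite finField_genPoly -big_enum /= => /dvdp_prod_XsubC[m eq_p].
rewrite (eqp_size eq_p) size_prod_XsubC /=.
rewrite -(card_uniqP (mask_uniq (enum_uniq L) m)).
by apply: eq_card => x; rewrite inE (eqp_root eq_p) root_prod_XsubC.
Qed.

(** X^a - u divides X^(ab) - u^b = X^(ab) - 1, which divides X^(#|L|-1) - 1. *)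
Lemma card_pow_eq (L : finFieldType) (a b : nat) (u : L) :
  (0 < a)%N -> (a * b %| #|L|.-1)%N -> u ^+ b = 1 ->
  #|[set x : L | x ^+ a == u]| = a.
Proof.
move=> a_gt0 /dvdnP[k Dk] ub1.
transitivity #|[set x : L | root ('X^a - u%:P) x]|.
  by apply: eq_card => x; rewrite !inE rootE !hornerE subr_eq0.
rewrite card_roots_dvd_genPoly ?size_XnsubC //.
have L_gt0 : (0 < #|L|)%N by apply: leq_trans (finNzRing_gt1 L).
have -> : 'X^#|L| - 'X = ('X^(#|L|.-1) - 1) * 'X :> {poly L}.
  by rewrite mulrBl mul1r -exprSr prednK.
rewrite dvdp_mulr // Dk mulnC !exprM -[X in _ %| _ - X](expr1n _ k) subrXX dvdp_mulr //.
by rewrite -[1]/(1%:P) -ub1 polyC_exp subrXX dvdp_mulr.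
Qed.

(** L is a splitting field of X^m - X with m = q^n.  The roots of this polynomial
    are distinct, its derivative being -1; they are the fixed points of a power of
    the Frobenius automorphism, hence form a subfield, which must be all of L. *)
Lemma finField_extension (F : finFieldType) (n : nat) : (0 < n)%N ->
  exists (L : finFieldType) (iota : {rmorphism F -> L}), #|L| = (#|F| ^ n)%N.
Proof.
move=> n_gt0; set m := (#|F| ^ n)%N.
have m_gt1 : (1 < m)%N by rewrite -(exp1n n) ltn_exp2r ?finNzRing_gt1.
pose q (R : nzRingType) : {poly R} := 'X^m - 'X.
have szq (R : nzRingType) : size (q R) = m.+1.
  by rewrite size_polyDl size_polyXn // size_polyN size_polyX.
have /FinSplittingFieldFor[/= L splitLq] : q F != 0.
  by rewrite -size_poly_eq0 szq.
rewrite [map_poly _ _]rmorphB rmorphXn /= map_polyX -/(q L) in splitLq.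
have [zs DqL defL] := splitLq.
pose Fm := FinFieldExtType L.
exists Fm, (in_alg (finvect_type L)).
(* The generator a of the Galois group is the Frobenius map, so Em is the set of
   roots of X^m - X. *)
have /finField_galois_generator[/= a _ Da] : (1 <= {:L})%VS by apply: sub1v.
pose Em := fixedSpace (a ^+ n)%g; 
have {}Da x : a x = x ^+ #|F| by rewrite Da ?memvf // dimv1.
have m0 : m%:R = 0 :> L.
  have [p p_pr pF] := finPcharP F.
  have [/= k Dk] : exists k, #|F| = (p ^ k.+1)%N.
    have := pnat_card_finField F; rewrite (eq_pnat _ (pcharf_eq pF)).
    case/p_natP => -[|k] Dk; last by exists k.
    by have := finNzRing_gt1 F; rewrite Dk.
  have pL : p \in [pchar L] by rewrite pchar_lalg.
  by rewrite /m Dk !natrX (pcharf0 pL) !expr0n gtn_eqF.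
have Uzs : uniq zs.
  have : separable_poly (q L).
    rewrite unlock derivB derivXn derivX -mulr_natl -polyC_natr m0.
    by rewrite mul0r sub0r -scaleN1r coprimepZr ?oppr_eq0 ?oner_eq0 ?coprimep1.
  by rewrite (eqp_separable DqL) separable_prod_XsubC.
suffices /eq_card-> : Fm =i zs.
  apply: succn_inj; rewrite (card_uniqP _) //= -(size_prod_XsubC _ id).
  by rewrite -(eqp_size DqL) szq.
have in_zs : zs =i Em.
  move=> z; rewrite -root_prod_XsubC -(eqp_root DqL) (sameP fixedSpaceP eqP).
  rewrite /root !hornerE subr_eq0 /= /m; congr (_ == z).
  elim: (n) => [|i IHi]; first by rewrite gal_id.
  by rewrite expgSr expnSr exprM IHi galM ?memvf ?Da.
suffices defEm : Em = {:L}%VS by move=> z; rewrite in_zs defEm memvf.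
apply/eqP; rewrite eqEsubv subvf -defL -[Em]subfield_closed agenvS //.
by rewrite subv_add sub1v; apply/span_subvP=> z; rewrite in_zs.
Qed.

(** * Frobenius orbits and irreducible polynomials *)

Section FrobeniusOrbits.

Variables (F L : finFieldType) (iota : {rmorphism F -> L}).

Definition frob (x : L) := x ^+ #|F|.
(** The degree of x over F, as the length of its Frobenius orbit. *)
Definition fdeg (x : L) := fingraph.order frob x.
(** The minimal polynomial of x over F, with coefficients read in L. *)
Definition orbit_poly (x : L) := \prod_(y <- fingraph.orbit frob x) ('X - y%:P).

Lemma pnat_card_ext : [pchar L].-nat #|F|.
Proof.
rewrite (eq_pnat _ (fmorph_pchar iota)); exact: pnat_card_finField.
Qed.

Lemma frob_inj : injective frob.
Proof. exact: pchar_power_inj pnat_card_ext. Qed.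

Lemma iter_frob i x : iter i frob x = x ^+ (#|F| ^ i).
Proof. by elim: i => //= i ->; rewrite /frob -exprM expnSr. Qed.

Lemma fdeg_gt0 x : (0 < fdeg x)%N.
Proof. exact: fingraph.order_gt0. Qed.

Lemma fdeg_dvdP m x : (x ^+ (#|F| ^ m) == x) = (fdeg x %| m)%N.
Proof.
have cyc k : iter (k * fdeg x) frob x = x.
  elim: k => // k IHk.
  by rewrite mulSn iterD IHk; apply: iter_order frob_inj x.
rewrite -iter_frob; apply/eqP/idP => [|/dvdnP[k ->] //].
rewrite {1}(divn_eq m (fdeg x)) addnC iterD cyc => fixx.
have lt_r : (m %% fdeg x < fdeg x)%N by rewrite ltn_mod fdeg_gt0.
by rewrite /dvdn -(findex_iter lt_r) fixx findex0.
Qed.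

Lemma frob_orbit_ex x y : y \in fingraph.orbit frob x ->
  exists2 i, (i < fdeg x)%N & y = x ^+ (#|F| ^ i).
Proof.
rewrite -fconnect_orbit => xy; exists (findex frob x y).
  exact: findex_max.
by rewrite -iter_frob iter_findex.
Qed.

(** X^q - X is the product of the X - c for c in F, so it has no other roots. *)
Lemma frob_fixed x : x ^+ #|F| = x -> exists c, x = iota c.
Proof.
move=> fx; have := congr1 (fun p => (map_poly iota p).[x]) (finField_genPoly F).
rewrite rmorphB /= map_polyXn map_polyX !hornerE fx subrr rmorph_prod.
rewrite horner_prod => /esym/eqP; rewrite prodf_seq_eq0 => /hasP[c _].
by rewrite /= rmorphB /= map_polyX map_polyC !hornerE subr_eq0 => /eqP; exists c.
Qed.

Lemma iota_fixed c : iota c ^+ #|F| = iota c.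
Proof. by rewrite -rmorphXn expf_card. Qed.

Lemma size_orbit_poly x : size (orbit_poly x) = (fdeg x).+1.
Proof. by rewrite size_prod_XsubC size_orbit. Qed.

Lemma monic_orbit_poly x : orbit_poly x \is monic.
Proof. exact: monic_prod_XsubC. Qed.

(** A polynomial over F commutes with Frobenius, so it vanishes on whole orbits. *)
Lemma orbit_poly_dvd (f : {poly F}) x :
  root (map_poly iota f) x -> orbit_poly x %| map_poly iota f.
Proof.
move=> fx; apply: uniq_roots_dvdp; last by rewrite uniq_rootsE orbit_uniq.
apply/allP => y /frob_orbit_ex[i _ ->]; elim: i => [|i IHi]; first by rewrite expr1.
rewrite expnSr exprM; move: (x ^+ _) IHi => z /rootP fz; apply/rootP.
rewrite -[RHS](rmorph0 (power_map pnat_card_ext)) -fz.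
rewrite -[RHS]horner_map -map_poly_comp; congr horner.
by apply: eq_map_poly => c; rewrite /= /power_map iota_fixed.
Qed.

(** Frobenius permutes the roots of [orbit_poly x], so it fixes its coefficients. *)
Lemma orbit_poly_descends x : exists f : {poly F}, map_poly iota f = orbit_poly x.
Proof.
have fixP : map_poly (power_map pnat_card_ext) (orbit_poly x) = orbit_poly x.
  rewrite rmorph_prod /= /orbit_poly.
  rewrite (eq_bigr (fun y => 'X - (frob y)%:P)); last first.
    by move=> y _; rewrite rmorphB /= map_polyX map_polyC.
  rewrite -(big_map frob xpredT (fun y => 'X - y%:P)); apply: perm_big.
  apply: uniq_perm; rewrite ?(map_inj_uniq frob_inj) ?orbit_uniq //.
  have subo : {subset map frob (fingraph.orbit frob x) <= fingraph.orbit frob x}.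
    move=> _ /mapP[y + ->]; rewrite -!fconnect_orbit => /connect_trans->//.
    exact: fconnect1.
  apply: (uniq_min_size _ subo _).2; rewrite ?size_map //.
  by rewrite (map_inj_uniq frob_inj) orbit_uniq.
pose g := \poly_(i < size (orbit_poly x))
            odflt 0 [pick c | iota c == (orbit_poly x)`_i].
exists g; apply/polyP => i; rewrite coef_map coef_poly.
case: ltnP => [_ | le_i]; last by rewrite [RHS]nth_default //= raddf0.
case: pickP => [c /eqP Dc | no_c] /=; first exact: Dc.
have /frob_fixed[c Dc] : (orbit_poly x)`_i ^+ #|F| = (orbit_poly x)`_i.
  by rewrite -{2}fixP coef_map.
by have := no_c c; rewrite -Dc eqxx.
Qed.

Lemma orbit_root x : root (orbit_poly x) x.
Proof. by rewrite root_prod_XsubC -fconnect_orbit connect0. Qed.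

Lemma irreducible_orbit_poly (f : {poly F}) x :
  f \is monic -> irreducible_poly f -> root (map_poly iota f) x ->
  map_poly iota f = orbit_poly x.
Proof.
move=> fmon [_ firr] fx; have [g Dg] := orbit_poly_descends x.
have gf : g %| f by rewrite -(dvdp_map iota) Dg orbit_poly_dvd.
have gmon : g \is monic by rewrite -(map_monic iota) Dg monic_orbit_poly.
have szg : size g != 1.
  by rewrite -(size_map_poly iota) Dg size_orbit_poly eqSS -lt0n fdeg_gt0.
by have := firr g szg gf; rewrite eqp_monic // => /eqP <-.
Qed.

(** A nonconstant factor over F of [orbit_poly x] has a root in the orbit of x,
    and therefore vanishes on the whole orbit. *)
Lemma orbit_poly_irreducible (f : {poly F}) x :
  map_poly iota f = orbit_poly x -> irreducible_poly f.
Proof.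
move=> Df; have szf : size f = (fdeg x).+1.
  by rewrite -(size_map_poly iota) Df size_orbit_poly.
split=> [|h szh hf]; first by rewrite szf ltnS fdeg_gt0.
have := hf; rewrite -(dvdp_map iota) Df => /dvdp_prod_XsubC[m eq_h].
have : size (map_poly iota h) != 1 by rewrite size_map_poly.
rewrite (eqp_size eq_h) size_prod_XsubC eqSS.
case Dm: (mask m _) => [|y s] // _.
have yx : y \in fingraph.orbit frob x.
  by apply: (@mem_mask _ _ m); rewrite Dm mem_head.
have hy : root (map_poly iota h) y by rewrite (eqp_root eq_h) root_prod_XsubC Dm mem_head.
rewrite /eqp hf -(dvdp_map iota) Df.
suffices hx : root (map_poly iota h) x by rewrite orbit_poly_dvd.
apply: root_dvdp (orbit_poly_dvd hy) _.
by rewrite root_prod_XsubC -fconnect_orbit (fconnect_sym frob_inj) fconnect_orbit.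
Qed.

End FrobeniusOrbits.

(** In the field F[X]/(f), which has q^(deg f) elements, the class of X is fixed
    by the power map of exponent q^(deg f). *)
Lemma irreducible_dvd_Xq (F : finFieldType) (f : {poly F}) :
  f \is monic -> irreducible_poly f -> f %| 'X^(#|F| ^ (size f).-1) - 'X.
Proof.
move=> fmon firr; pose hI : monic_irreducible_poly f := (firr, fmon).
pose K := {poly %/ f with hI}.
have XN : (in_qpoly f 'X : K) ^+ #|K| = in_qpoly f 'X by apply: expf_card.
have Xk k : in_qpoly f ('X^k) = (in_qpoly f 'X : K) ^+ k.
  elim: k => [|k IHk]; first by rewrite !expr0 in_qpoly1.
  by rewrite !exprS in_qpolyM IHk.
have := Xk #|K|; rewrite XN => /(congr1 val)/= /eqP.
rewrite -!Pdiv.IdomainMonic.modpE ?(mk_monicE hI) // card_qfpoly.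
by rewrite -subr_eq0 -modpN -modpD.
Qed.

Section CountByDegree.

Variables (F L : finFieldType) (iota : {rmorphism F -> L}) (n : nat).
Hypothesis cardL : #|L| = (#|F| ^ n)%N.

Lemma fdeg_dvd (x : L) : (fdeg F x %| n)%N.
Proof. by rewrite -(fdeg_dvdP iota) -cardL expf_card. Qed.

Lemma card_irreducible_roots (f : {poly F}) :
  f \is monic -> irreducible_poly f -> size f = n.+1 ->
  #|[set x | root (map_poly iota f) x]| = n.
Proof.
move=> fmon firr szf; rewrite card_roots_dvd_genPoly ?size_map_poly ?szf //.
have := irreducible_dvd_Xq fmon firr; rewrite -(dvdp_map iota) szf /= -cardL.
by rewrite rmorphB /= map_polyXn map_polyX.
Qed.

Lemma fdeg_irreducible_root (f : {poly F}) x :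
  f \is monic -> irreducible_poly f -> root (map_poly iota f) x ->
  size f = (fdeg F x).+1.
Proof.
move=> fmon firr fx.
by rewrite -(size_map_poly iota) (irreducible_orbit_poly fmon firr fx) size_orbit_poly.
Qed.

(** Double counting of the pairs (f, x) with x a root of f. *)
Lemma num_irred_fdeg (P : pred {poly F}) (Q : pred L) :
  (forall f x, f \is monic -> irreducible_poly f -> size f = n.+1 ->
     root (map_poly iota f) x -> P f = Q x) ->
  (num_irred n P * n)%N = #|[set x : L | (fdeg F x == n) && Q x]|.
Proof.
move=> PQ; rewrite /num_irred; set S := [set f | _].
have SP (f : {poly_n.+1 F}) : f \in S ->
    [/\ size f = n.+1, (f : {poly F}) \is monic, irreducible_poly f & P f].
  by rewrite inE => /and4P[/eqP ? ? /irreducibleP ? ?].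
rewrite -sum_nat_const.
transitivity (\sum_(f in S) \sum_(x : L | root (map_poly iota f) x) 1)%N.
  apply: eq_bigr => f /SP[szf fmon firr _].
  by rewrite sum1dep_card card_irreducible_roots.
rewrite (exchange_big_dep xpredT) //= -sum1dep_card [RHS]big_mkcond /=.
apply: eq_bigr => x _; rewrite sum1dep_card.
case: ifPn => [/andP[/eqP dx Qx] | nx].
  have [g Dg] := orbit_poly_descends iota x.
  have szg : size g = n.+1 by rewrite -(size_map_poly iota) Dg size_orbit_poly dx.
  have gmon : g \is monic by rewrite -(map_monic iota) Dg monic_orbit_poly.
  have girr := orbit_poly_irreducible Dg.
  have gx : root (map_poly iota g) x by rewrite Dg orbit_root.
  rewrite -(cards1 (npolyp n.+1 g)); apply: eq_card => f; rewrite 2!inE.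
  have valg : npolyp n.+1 g = g :> {poly F} by rewrite npolypK ?szg.
  apply/andP/eqP => [[/SP[szf fmon firr _] fx] | ->].
    apply: val_inj; rewrite /= valg; apply: (map_poly_inj iota).
    by rewrite Dg (irreducible_orbit_poly fmon firr fx).
  rewrite valg; split=> //; rewrite inE valg szg eqxx gmon /=.
  by rewrite (PQ g x) // Qx andbT; apply/irreducibleP.
apply: eq_card0 => f; rewrite inE; apply: contraNF nx => /andP[/SP[szf fmon firr Pf] fx].
rewrite -(PQ f x) // Pf andbT.
by have := fdeg_irreducible_root fmon firr fx; rewrite szf => -[<-].
Qed.

End CountByDegree.

(** * Moebius inversion and the sieve over prime divisors *)

Lemma mobius_primeM p d : prime p -> (0 < d)%N ->
  mobius (p * d) = if (p %| d)%N then 0 else - mobius d.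
Proof.
move=> p_pr d_gt0; have p_gt0 := prime_gt0 p_pr.
rewrite /mobius; have [pd | p'd] := boolP (p %| d)%N.
  case: ifPn => // /allP/(_ p); rewrite mem_primes p_pr muln_gt0 p_gt0 d_gt0.
  rewrite dvdn_mulr // => /(_ isT)/eqP.
  rewrite lognM // logn_prime // eqxx /= => -[/eqP].
  by rewrite -leqn0 leqNgt logn_gt0 mem_primes p_pr d_gt0 pd.
have perm_p : perm_eq (primes (p * d)) (p :: primes d).
  apply: uniq_perm; rewrite /= ?primes_uniq ?mem_primes ?(negPf p'd) ?andbF //.
  by move=> r; rewrite primesM // primes_prime // !inE.
have lp : logn p d = 0%N.
  by apply/eqP; rewrite -leqn0 leqNgt logn_gt0 mem_primes (negPf p'd) !andbF.
have -> : size (primes (p * d)) = (size (primes d)).+1 by rewrite (perm_size perm_p).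
rewrite (perm_all _ perm_p) /= {1}lognM // logn_prime // eqxx lp eqxx /=.
have -> : all (fun r => logn r (p * d) == 1)%N (primes d)
        = all (fun r => logn r d == 1)%N (primes d).
  apply: eq_in_all => r; rewrite mem_primes => /and3P[_ _ rd].
  rewrite lognM // logn_prime //.
  by have [rp|] := eqVneq r p; first by rewrite -rp rd in p'd.
by case: ifP => _; rewrite ?oppr0 // exprS mulN1r.
Qed.

(** For a prime p dividing n, the divisors d prime to p and the divisors p * d
    cancel in pairs; the other multiples of p contribute zero. *)
Lemma sum_mobius n : (0 < n)%N ->
  \sum_(d <- divisors n) mobius d = (n == 1)%:R.
Proof.
move=> n_gt0; case: eqVneq => [-> | n_neq1].
  by rewrite -[divisors 1]/[:: 1%N] big_seq1.
have n_gt1 : (1 < n)%N by case: n n_gt0 n_neq1 => [|[]].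
have p_pr := pdiv_prime n_gt1; set p := pdiv n in p_pr.
have p_n : (p %| n)%N by apply: pdiv_dvd.
rewrite (bigID (fun d => p %| d)%N) /= addrC.
rewrite [X in _ + X](_ : _ = - \sum_(d <- divisors n | ~~ (p %| d)%N) mobius d).
  by rewrite subrr.
rewrite -sumrN.
pose D := [seq (p * e)%N | e <- divisors (n %/ p)].
transitivity (\sum_(d <- D) mobius d).
  rewrite -big_filter; apply: perm_big; apply: uniq_perm.
  - by rewrite filter_uniq ?divisors_uniq.
  - rewrite map_inj_uniq ?divisors_uniq //.
    by apply: can_inj (fun e => e %/ p)%N _ => e; rewrite mulKn ?prime_gt0.
  move=> d; rewrite mem_filter -dvdn_divisors //.
  have np_gt0 : (0 < n %/ p)%N by rewrite divn_gt0 ?prime_gt0 // dvdn_leq.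
  apply/andP/mapP => [[/dvdnP[e De] dn] | [e + ->]].
    exists e; last by rewrite mulnC.
    by rewrite -dvdn_divisors // dvdn_divRL // -De.
  by rewrite -dvdn_divisors // dvdn_divRL // [(e * p)%N]mulnC => en; rewrite dvdn_mulr.
rewrite big_map.
have np_gt0 : (0 < n %/ p)%N by rewrite divn_gt0 ?prime_gt0 // dvdn_leq.
transitivity (\sum_(e <- divisors (n %/ p) | ~~ (p %| e)%N) - mobius e).
  rewrite [RHS]big_mkcond; rewrite !big_seq; apply: eq_bigr => e.
  rewrite -dvdn_divisors // => e_np.
  by rewrite mobius_primeM // ?(dvdn_gt0 np_gt0) //; case: ifP.
rewrite -big_filter -[RHS]big_filter; apply: perm_big.
apply: uniq_perm; rewrite ?filter_uniq ?divisors_uniq // => d.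
rewrite !mem_filter -!dvdn_divisors //; case pd: (p %| d)%N => //=.
rewrite dvdn_divRL // Gauss_dvd ?p_n ?andbT //.
by rewrite coprime_sym prime_coprime ?pd.
Qed.

Section Sieve.

Variables (F L : finFieldType) (iota : {rmorphism F -> L}) (n : nat).
Hypotheses (n_gt0 : (0 < n)%N) (cardL : #|L| = (#|F| ^ n)%N).
Variable A : {set L}.

Let full := #|[set x in A | fdeg F x == n]|.
(** The number of elements of A in the subfield of degree n / d over F. *)
Definition fixed_by d := #|[set x in A | x ^+ (#|F| ^ (n %/ d)) == x]|.

(** An x of degree e is counted with the sum of mobius d over the d such that e
    divides n / d, that is over the divisors d of n / e. *)
Lemma card_fdeg_mobius :
  full%:Z = \sum_(d <- divisors n) mobius d * (fixed_by d)%:Z.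
Proof.
pose fx d x := x ^+ (#|F| ^ (n %/ d)) == x :> L.
transitivity (\sum_(x in A) \sum_(d <- divisors n) mobius d * (fx d x)%:R).
  rewrite /full -sum1dep_card -natz natr_sum /= [LHS]big_mkcondr /=.
  apply: eq_bigr => x _.
  have x_n := fdeg_dvd iota cardL x; have x_gt0 := fdeg_gt0 F x.
  have nx_gt0 : (0 < n %/ fdeg F x)%N by rewrite divn_gt0 // dvdn_leq.
  transitivity (\sum_(d <- divisors (n %/ fdeg F x)) mobius d).
    rewrite sum_mobius //; case: eqVneq => [-> | xn]; first by rewrite divnn n_gt0.
    case: eqP => // nx1; case/eqP: xn.
    by rewrite -(divnK x_n) nx1 mul1n.
  transitivity (\sum_(d <- divisors n | fx d x) mobius d); last first.
    by rewrite big_mkcond; apply: eq_bigr => d _; case: (fx d x); rewrite ?mulr1 ?mulr0.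
  rewrite -[RHS]big_filter; apply: perm_big; apply: uniq_perm.
  - exact: divisors_uniq.
  - by rewrite filter_uniq ?divisors_uniq.
  move=> d; rewrite mem_filter /fx (fdeg_dvdP iota) -!dvdn_divisors //.
  rewrite dvdn_divRL //; apply/idP/andP => [dxn | [xnd dn]].
    have dn : (d %| n)%N by apply: dvdn_trans dxn; apply: dvdn_mulr.
    by rewrite dvdn_divRL // mulnC.
  by rewrite mulnC -dvdn_divRL.
rewrite exchange_big /=; apply: eq_bigr => d _; rewrite -mulr_sumr; congr (_ * _).
rewrite /fixed_by -sum1dep_card -natz natr_sum big_mkcondr /=.
by apply: eq_bigr => x _; rewrite /fx; case: ifP.
Qed.

Lemma card_fdeg_le : (full <= #|A|)%N.
Proof. by apply: subset_leq_card; apply/subsetP => x; rewrite inE => /andP[]. Qed.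

(** An element of degree e < n is fixed by x |-> x^(q^(n/p)) for any prime p
    dividing n / e. *)
Lemma card_fdeg_ge : (#|A| <= full + \sum_(p <- primes n) fixed_by p)%N.
Proof.
have subA x : x \in A -> (fdeg F x != n) ->
    has (fun p => x ^+ (#|F| ^ (n %/ p)) == x) (primes n).
  move=> _ xn; have x_n := fdeg_dvd iota cardL x.
  have nx_gt0 : (0 < n %/ fdeg F x)%N by rewrite divn_gt0 ?fdeg_gt0 // dvdn_leq.
  have nx_gt1 : (1 < n %/ fdeg F x)%N.
    rewrite ltn_neqAle nx_gt0 andbT; apply: contra xn => /eqP nx1.
    by rewrite -[X in _ == X](divnK x_n) -nx1 mul1n.
  apply/hasP; exists (pdiv (n %/ fdeg F x)).
    rewrite mem_primes pdiv_prime // n_gt0.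
    exact: dvdn_trans (pdiv_dvd _) (dvdn_div _).
  rewrite (fdeg_dvdP iota) dvdn_divRL; last exact: dvdn_trans (pdiv_dvd _) (dvdn_div _).
  by rewrite mulnC -dvdn_divRL // pdiv_dvd.
have cardE (P : pred L) : #|[set x in A | P x]| = (\sum_(x in A) P x)%N.
  rewrite -sum1dep_card big_mkcondr; apply: eq_bigr => x _; by case: (P x).
rewrite /full cardE (eq_bigr _ (fun p _ =>
  cardE (fun x => x ^+ (#|F| ^ (n %/ p)) == x))).
rewrite exchange_big -big_split -sum1_card; apply: leq_sum => x Ax.
have [_ | xn] := eqVneq; first by rewrite leq_addr.
have /hasP[p p_n xp] := subA x Ax xn.
by rewrite (big_rem p) //= xp addnA addn1 ltnS leq0n.
Qed.

End Sieve.

(** * Norms and symmetric polynomials *)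

(** The sum 1 + b + ... + b^(m-1), that is (b^m - 1)/(b - 1): with b = q this is
    the exponent of the norm from degree m down to F. *)
Definition geom (b m : nat) : nat := (\sum_(i < m) b ^ i)%N.

Lemma geomS b m : geom b m.+1 = (geom b m + b ^ m)%N.
Proof. exact: big_ord_recr. Qed.

Lemma geom_gt0 b m : (0 < m)%N -> (0 < geom b m)%N.
Proof. by case: m => // m _; rewrite /geom big_ord_recl. Qed.

Lemma geomD b m k : geom b (m + k) = (geom b m + b ^ m * geom b k)%N.
Proof.
elim: k => [|k IHk]; first by rewrite [geom b 0]big_ord0 muln0 !addn0.
by rewrite addnS !geomS IHk mulnDr expnD addnA.
Qed.

Lemma geom_pred b m : (b.-1 * geom b m = (b ^ m).-1)%N.
Proof. by rewrite predn_exp. Qed.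

Lemma geom_double b m : geom b (m * 2) = ((b ^ m).+1 * geom b m)%N.
Proof. by rewrite muln2 -addnn geomD mulSn. Qed.

Lemma geom_square s m : (s.+1 * geom (s ^ 2) m = geom s (m * 2))%N.
Proof.
elim: m => [|m IHm]; first by rewrite /geom !big_ord0 muln0.
have -> : (m.+1 * 2 = (m * 2).+2)%N by lia.
by rewrite !geomS -IHm mulnDr -expnM [(2 * m)%N]mulnC (expnS s (m * 2)) -addnA -mulSn.
Qed.

(** Raising to the power b^m is an involution on x, so only the parity of the
    number of iterations matters. *)
Lemma odd_iterated_power (A : pzSemiRingType) (x : A) b m k :
  x ^+ (b ^ (m * 2)) = x -> odd k -> x ^+ (b ^ (k * m)) = x ^+ (b ^ m).
Proof.
move=> fixx odd_k; rewrite -[k]odd_double_half odd_k.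
elim: k./2 => [|j IHj]; first by rewrite mul1n.
have -> : ((true + j.+1.*2) * m = m * 2 + (true + j.*2) * m)%N by lia.
by rewrite expnD exprM fixx.
Qed.

Section StarPoly.

Variables (F : fieldType) (h : {poly F}).
Hypothesis h0 : h`_0 != 0.

Lemma coef_starpoly j :
  (starpoly h)`_j = if (j < size h)%N then (h`_0)^-1 * h`_((size h).-1 - j) else 0.
Proof.
rewrite /starpoly coefZ coef_sum; case: ifP => jh.
  have h_gt0 : (0 < size h)%N by apply: leq_ltn_trans jh.
  have j_le : (j <= (size h).-1)%N by rewrite -ltnS prednK.
  have lt_i : ((size h).-1 - j < size h)%N.
    by rewrite (leq_ltn_trans (leq_subr _ _)) ?prednK.
  rewrite (bigD1 (Ordinal lt_i)) //= coefZ coefXn subKn // eqxx mulr1.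
  rewrite big1 ?addr0 // => i; rewrite -val_eqE /= => ne_i.
  rewrite coefZ coefXn; case: eqP => [Dj|]; rewrite ?mulr0 //.
  by case/eqP: ne_i; have := ltn_ord i; lia.
rewrite big1 ?mulr0 // => i _; rewrite coefZ coefXn.
by case: eqP => [Dj|]; rewrite ?mulr0 //; have := ltn_ord i; lia.
Qed.

Lemma size_starpoly : size (starpoly h) = size h.
Proof.
have h_gt0 : (0 < size h)%N.
  by rewrite size_poly_gt0; apply: contraNneq h0 => ->; rewrite coef0.
apply/eqP; rewrite eqn_leq; apply/andP; split.
  by apply/leq_sizeP => j hj; rewrite coef_starpoly ltnNge hj.
rewrite -{1}(prednK h_gt0) ltnNge; apply/negP => /leq_sizeP/(_ _ (leqnn _)).
rewrite coef_starpoly prednK // leqnn subnn => /eqP.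
by rewrite mulVf // oner_eq0.
Qed.

Lemma monic_starpoly : starpoly h \is monic.
Proof.
have h_gt0 : (0 < size h)%N.
  by rewrite size_poly_gt0; apply: contraNneq h0 => ->; rewrite coef0.
by rewrite monicE lead_coefE size_starpoly coef_starpoly prednK // leqnn subnn mulVf.
Qed.

Lemma root_starpoly (L : fieldType) (iota : {rmorphism F -> L}) (x : L) :
  x != 0 -> root (map_poly iota h) x -> root (map_poly iota (starpoly h)) x^-1.
Proof.
move=> x0 /rootP; rewrite horner_coef size_map_poly => hx; apply/rootP.
rewrite /starpoly map_polyZ /= rmorph_sum hornerZ horner_sum.
rewrite (eq_bigr (fun i : 'I_(size h) =>
    x^-1 ^+ (size h).-1 * ((map_poly iota h)`_i * x ^+ i))); last first.
  move=> i _; rewrite /= map_polyZ /= hornerZ map_polyXn hornerXn coef_map /=.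
  have le_i : (i <= (size h).-1)%N by have := ltn_ord i; lia.
  rewrite mulrCA -{2}(subnK le_i) exprD -mulrA -exprMn mulVf // expr1n mulr1.
  by [].
by rewrite -mulr_sumr hx !mulr0.
Qed.

End StarPoly.

(** Star-symmetry is treated as the case s = 1 of dagger-symmetry, the bar map
    being then the identity. *)
Lemma star_dagger (F : fieldType) (f : {poly F}) :
  star_symmetric f = dagger_symmetric 1 f.
Proof.
rewrite /star_symmetric /dagger_symmetric /daggerpoly /barpoly.
by rewrite map_poly_id // => x _; rewrite expr1.
Qed.

(** Inverting twice gives x = x^(q^(2i)), so the degree divides 2i, which is less than
    twice the degree; i = 0 is the case of x = x^-1. *)
Lemma inv_conjugate_fdeg (F L : finFieldType) (iota : {rmorphism F -> L}) (x : L) i :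
  x != 0 -> (i < fdeg F x)%N -> x^-1 = x ^+ (#|F| ^ i) ->
  x ^+ 2 = 1 \/ fdeg F x = (i * 2)%N.
Proof.
move=> x0 lt_i xi.
have : (fdeg F x %| i * 2)%N.
  by rewrite -(fdeg_dvdP iota) muln2 -addnn expnD exprM -xi exprVn -xi invrK.
case/dvdnP => -[|[|k]] Dk; [left | right | ].
- have i0 : i = 0%N by lia.
  by rewrite expr2 -{1}[x]invrK xi i0 expn0 expr1 mulVf.
- by rewrite Dk mul1n.
- by have := fdeg_gt0 F x; nia.
Qed.

Section RootsOfSymmetric.

Variables (F L : finFieldType) (iota : {rmorphism F -> L}).
Variables (f : {poly F}) (x : L).
Hypotheses (fmon : f \is monic) (firr : irreducible_poly f).
Hypothesis fx : root (map_poly iota f) x.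

Lemma root_irreducibleP y :
  reflect (exists2 i, (i < fdeg F x)%N & y = x ^+ (#|F| ^ i))
          (root (map_poly iota f) y).
Proof.
rewrite (irreducible_orbit_poly fmon firr fx) root_prod_XsubC.
apply: (iffP idP) => [/frob_orbit_ex // | [i _ ->]].
by rewrite -iter_frob -fconnect_orbit fconnect_iter.
Qed.

Lemma root_frob_pow i : root (map_poly iota f) (x ^+ (#|F| ^ i)).
Proof.
rewrite (irreducible_orbit_poly fmon firr fx) root_prod_XsubC.
by rewrite -iter_frob -fconnect_orbit fconnect_iter.
Qed.

Lemma coef0_norm :
  iota f`_0 = (-1) ^+ fdeg F x * x ^+ geom #|F| (fdeg F x).
Proof.
rewrite -coef_map (irreducible_orbit_poly fmon firr fx) -horner_coef0.
rewrite horner_prod /fingraph.orbit -/(fdeg F x) (big_nth x) size_traject big_mkord.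
rewrite /geom -prodrXr -[X in (-1) ^+ X](card_ord (fdeg F x)) -prodrN.
by apply: eq_bigr => i _; rewrite nth_traject // iter_frob !hornerE.
Qed.

Lemma root_neq0 : (f`_0 != 0) = (x != 0).
Proof.
rewrite -(fmorph_eq0 iota) coef0_norm mulf_eq0 signr_eq0 /= expf_eq0.
by rewrite geom_gt0 ?fdeg_gt0.
Qed.

(** The transform of f is monic of the same degree and vanishes at x^(-s), so it
    is equal to the irreducible f as soon as f also vanishes there. *)
Lemma dagger_symmetric_root s : [pchar F].-nat s ->
  dagger_symmetric s f = (x != 0) && root (map_poly iota f) (x ^+ s)^-1.
Proof.
move=> ps; rewrite /dagger_symmetric root_neq0; case: eqVneq => //= x0.
have psL : [pchar L].-nat s by rewrite (eq_pnat _ (fmorph_pchar iota)).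
have s_gt0 : (0 < s)%N by case/andP: ps.
have barE : barpoly s f = map_poly (power_map ps) f by [].
have b0 : (barpoly s f)`_0 != 0.
  by rewrite barE coef_map /= fmorph_eq0 root_neq0.
have barx : root (map_poly iota (barpoly s f)) (x ^+ s).
  apply/rootP; rewrite barE -map_poly_comp.
  rewrite (eq_map_poly (g := power_map psL \o iota)); last first.
    by move=> c; rewrite /= /power_map rmorphXn.
  rewrite map_poly_comp -[x ^+ s]/(power_map psL x) horner_map /=.
  by rewrite (rootP fx) /power_map expr0n gtn_eqF.
have xs0 : x ^+ s != 0 by rewrite expf_neq0.
have stx := root_starpoly b0 xs0 barx.
have sz : size (daggerpoly s f) = size f.
  by rewrite size_starpoly // barE size_map_poly.
apply/eqP/idP => [Df | fxs]; first by rewrite -{1}Df.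
have fd : f %| daggerpoly s f.
  rewrite -(dvdp_map iota) (irreducible_orbit_poly fmon firr fxs).
  exact: orbit_poly_dvd.
by apply/esym/eqP; rewrite -eqp_monic ?monic_starpoly // -dvdp_size_eqp // sz.
Qed.

Hypothesis x0 : x != 0.

(** The map x |-> x^(-s) on the orbit has for square the Frobenius map.  If
    x^(-s) is conjugate to x, then x^-1 = x^(s^(2k+1)) for some k; applied twice this
    shows that the degree N divides 2k+1, hence is odd, and 2k+1 may be reduced to
    N since s^(2N) acts trivially.  Conversely x^-1 = x^(s^N) makes x^(-s)
    conjugate to x because N + 1 is even. *)
Lemma dagger_root_odd s : #|F| = (s ^ 2)%N ->
  root (map_poly iota f) (x ^+ s)^-1 =
  odd (fdeg F x) && (x ^+ (s ^ fdeg F x).+1 == 1).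
Proof.
move=> Dq; set N := fdeg F x.
have psL : [pchar L].-nat s.
  by have := pnat_card_ext iota; rewrite Dq pnatX orbF.
have powqE k : (#|F| ^ k = s ^ (k * 2))%N by rewrite Dq -expnM mulnC.
have fixN : x ^+ (s ^ (N * 2)) = x.
  by apply/eqP; rewrite -powqE (fdeg_dvdP iota).
apply/idP/andP => [/root_irreducibleP[i _ xi] | [oddN /eqP xN]].
  (* The exponent i is raised by the period N to make it positive, so that one
     factor s can be cancelled from q^(k+1) = s^(2k+1) * s. *)
  have [k Dk] : exists k, (i + N = k.+1)%N.
    by exists (i + N).-1; rewrite prednK // addn_gt0 fdeg_gt0 orbT.
  have xk : x ^+ (s ^ (k * 2).+1) = x^-1.
    apply: (pchar_power_inj psL); rewrite /= -exprM -expnSr.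
    have -> : (k * 2).+2 = (N * 2 + i * 2)%N by lia.
    by rewrite expnD exprM fixN -powqE -xi exprVn.
  have Nk : (N %| (k * 2).+1)%N.
    rewrite -(fdeg_dvdP iota) powqE muln2 -addnn expnD exprM xk exprVn xk.
    by rewrite invrK.
  have oddN : odd N by apply: dvdn_odd Nk _; rewrite /= oddM andbF.
  split=> //; have /dvdnP[c Dc] := Nk.
  have oddc : odd c by have := congr1 odd Dc; rewrite oddM oddN andbT /= oddM andbF.
  by rewrite exprS -(odd_iterated_power fixN oddc) -Dc xk mulfV.
have xsN : x ^+ (s ^ N) = x^-1.
  by apply: (mulfI x0); rewrite -exprS xN mulfV.
suff -> : (x ^+ s)^-1 = x ^+ (#|F| ^ N./2.+1) by apply: root_frob_pow.
have -> : (#|F| ^ N./2.+1 = s ^ N * s)%N.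
  by rewrite powqE -expnSr; congr expn; rewrite -{2}[N]odd_double_half oddN; lia.
by rewrite exprM xsN exprVn.
Qed.

End RootsOfSymmetric.

Lemma pchar_nat_sqrt (F : finFieldType) s : #|F| = (s ^ 2)%N -> [pchar F].-nat s.
Proof. by move=> Dq; have := pnat_card_finField F; rewrite Dq pnatX orbF. Qed.

Section ExistsRoot.

Variables (F : finFieldType) (f : {poly F}).
Hypotheses (fmon : f \is monic) (firr : irreducible_poly f).

Lemma irreducible_has_root :
  exists (L : finFieldType) (iota : {rmorphism F -> L}) (x : L),
    root (map_poly iota f) x.
Proof.
have [szf _] := firr; have n_gt0 : (0 < (size f).-1)%N by case: (size f) szf => [|[]].
have [L [iota cardL]] := finField_extension F n_gt0.
have := card_irreducible_roots (n := (size f).-1) iota cardL fmon firr.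
rewrite prednK ?(ltnW szf) // => /(_ erefl) card_roots.
have /card_gt0P[x] : (0 < #|[set x | root (map_poly iota f) x]|)%N by rewrite card_roots.
by rewrite inE => fx; exists L, iota, x.
Qed.

Lemma irreducible_root_XsubC c : root f c -> f = 'X - c%:P.
Proof.
move=> fc; have [_ firr'] := firr; apply/esym/eqP.
by rewrite -eqp_monic ?monicXsubC ?firr' ?size_XsubC ?dvdp_XsubCl.
Qed.

Lemma star_symmetric_even : star_symmetric f -> f != 'X - 1 -> f != 'X + 1 ->
  ~~ odd (size f).-1 /\ f`_0 = 1.
Proof.
have [L [iota [x fx]]] := irreducible_has_root.
rewrite star_dagger (dagger_symmetric_root fmon firr fx) // expr1.
case/andP=> x0 /(root_irreducibleP fmon firr fx)[i lt_i xi] f1 f2.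
case: (inv_conjugate_fdeg iota x0 lt_i xi) => [/eqP | Dd].
  rewrite sqrf_eq1 => /orP[] /eqP Dx.
    case/eqP: f1; rewrite -[1]/(1%:P); apply: irreducible_root_XsubC.
    by rewrite -(fmorph_root iota) rmorph1 -Dx.
  case/eqP: f2; rewrite -[X in 'X + X]opprK -[- 1]/(- 1%:P) -polyCN.
  by apply: irreducible_root_XsubC; rewrite -(fmorph_root iota) rmorphN1 -Dx.
have szf := fdeg_irreducible_root fmon firr fx.
split; first by rewrite szf Dd oddM andbF.
apply: (fmorph_inj iota); rewrite (coef0_norm fmon firr fx) Dd rmorph1.
rewrite exprM sqrr_sign mul1r geom_double exprM exprS -xi mulfV //.
exact: expr1n.
Qed.

Lemma dagger_symmetric_odd s : #|F| = (s ^ 2)%N -> dagger_symmetric s f ->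
  odd (size f).-1 /\ f`_0 ^+ s.+1 = 1.
Proof.
move=> Dq; have [L [iota [x fx]]] := irreducible_has_root.
have ps := pchar_nat_sqrt Dq.
rewrite (dagger_symmetric_root fmon firr fx ps) => /andP[x0].
rewrite (dagger_root_odd fmon firr fx) // => /andP[oddN /eqP xN].
have szf := fdeg_irreducible_root fmon firr fx.
split; first by rewrite szf.
apply: (fmorph_inj iota); rewrite rmorphXn /= (coef0_norm fmon firr fx) rmorph1.
rewrite exprMn -[X in _ * X]exprM Dq [(geom _ _ * _)%N]mulnC geom_square.
rewrite geom_double exprM xN expr1n mulr1.
have psL : [pchar L].-nat s by rewrite (eq_pnat _ (fmorph_pchar iota)).
by rewrite -signr_odd oddN expr1 exprS mulN1r power_mapN1 ?opprK.
Qed.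

End ExistsRoot.

(** * Counting elements of prescribed norm *)

Lemma card_fibers (T W : finType) (E : eqType) (h : T -> E) (j : W -> E)
    (B : {set T}) (V : {set W}) k :
  injective j -> (forall x, reflect (exists2 v, v \in V & h x = j v) (x \in B)) ->
  (forall v, v \in V -> #|[set x | h x == j v]| = k) -> #|B| = (#|V| * k)%N.
Proof.
move=> j_inj BP cardV; rewrite -sum_nat_const.
transitivity (\sum_(v in V) \sum_(x | h x == j v) 1)%N; last first.
  by apply: eq_bigr => v Vv; rewrite sum1dep_card cardV.
rewrite (exchange_big_dep xpredT) //= -sum1_card big_mkcond /=.
apply: eq_bigr => x _; rewrite sum1dep_card.
case: BP => [[v Vv hxv] | noV].
  rewrite -(cards1 v); apply: eq_card => w; rewrite !inE hxv (inj_eq j_inj) [LHS]eq_sym.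
  by case: eqVneq => [<-|_]; rewrite ?Vv ?andbF.
apply/esym/eq_card0 => v; rewrite inE; apply/andP => -[Vv /eqP hxv].
by apply: noV; exists v.
Qed.

(** Transitivity of the norm: an element of the subfield of degree m has as norm
    from degree d * m the d-th power of its norm from degree m. *)
Lemma pow_norm_tower (A : pzSemiRingType) (x : A) b m d :
  x ^+ (b ^ m) = x -> x ^+ geom b (d * m) = (x ^+ geom b m) ^+ d.
Proof.
move=> fixx; elim: d => [|d IHd]; first by rewrite mul0n [geom b 0]big_ord0.
by rewrite mulSn geomD exprD exprM fixx IHd exprS.
Qed.

(** Modulo s + 1, the sum 1 + s + ... + s^(m-1) alternates, hence is 1. *)
Lemma pow_geom_odd (A : pzSemiRingType) (y : A) s m :
  odd m -> y ^+ s.+1 = 1 -> y ^+ geom s m = y.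
Proof.
move=> odd_m ys; rewrite -[m]odd_double_half odd_m.
elim: m./2 => [|j IHj]; first by rewrite geomS [geom s 0]big_ord0 add0n expr1.
have -> : (true + j.+1.*2 = (true + j.*2).+2)%N by lia.
move: (true + _)%N IHj => t IHt; rewrite !geomS -addnA (expnS s t) -mulSn.
by rewrite exprD exprM ys expr1n mulr1.
Qed.

Lemma dvdn_odd_power s m : odd m -> (s.+1 %| (s ^ m).+1)%N.
Proof.
case: s => [|t] odd_m; first by rewrite dvd1n.
rewrite -[m]odd_double_half odd_m; set s := t.+1.
elim: m./2 => [|j IHj]; first by rewrite expn1.
rewrite -(dvdn_addl _ (dvdn_mulr t (dvdnn s.+1))).
suff -> : ((s ^ (true + j.+1.*2)).+1 + s.+1 * t = s ^ 2 * (s ^ (true + j.*2)).+1)%N.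
  exact: dvdn_mull.
have -> : (true + j.+1.*2 = 2 + (true + j.*2))%N by lia.
rewrite expnD; move: (s ^ (true + _))%N {IHj} => X; rewrite -mulnn /s.
by nia.
Qed.

Lemma uval_inj (F : finFieldType) : injective (@FinRing.uval F).
Proof. by move=> u v; apply: val_inj. Qed.

Section UnitsAndRoots.

Variables (F L : finFieldType) (iota : {rmorphism F -> L}).

Lemma iota_unit_inj : injective (fun v : {unit F} => iota (FinRing.uval v)).
Proof. by move=> u v /fmorph_inj/uval_inj. Qed.

Lemma iota_unitX (v : {unit F}) d :
  iota (FinRing.uval (v ^+ d)%g) = iota (FinRing.uval v) ^+ d.
Proof. by rewrite -rmorphXn; congr (iota _); apply: FinRing.val_unitX. Qed.

(** The (q-1)-th roots of unity of L are the nonzero elements of F. *)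
Lemma pow_pred_card y : y ^+ #|F|.-1 = 1 ->
  exists v : {unit F}, y = iota (FinRing.uval v).
Proof.
move=> y1; have q_gt1 := finNzRing_gt1 F.
have [c Dc] : exists c, y = iota c.
  by apply: frob_fixed; rewrite -(prednK (ltnW q_gt1)) exprS y1 mulr1.
have c0 : c != 0.
  apply: contra_eq_neq y1 => c0; rewrite Dc c0 rmorph0 expr0n.
  have q1_gt0 : (0 < #|F|.-1)%N by rewrite -ltnS prednK // ltnW.
  by rewrite gtn_eqF // eq_sym oner_eq0.
by exists (finField_unit c0).
Qed.

Lemma unit_pow_pred_card (v : {unit F}) : iota (FinRing.uval v) ^+ #|F|.-1 = 1.
Proof.
have v0 : FinRing.uval v != 0 by rewrite -unitfE; case: v.
apply/eqP; rewrite -rmorphXn fmorph_eq1; apply/eqP; apply: (mulfI v0).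
by rewrite mulr1 -exprS prednK ?expf_card // ltnW ?finNzRing_gt1.
Qed.

Variables (n : nat).
Hypotheses (n_gt0 : (0 < n)%N) (cardL : #|L| = (#|F| ^ n)%N).

Lemma fixed_pow m (x : L) : x ^+ (#|F| ^ m).-1 = 1 -> x ^+ (#|F| ^ m) = x.
Proof.
have q_gt0 : (0 < #|F| ^ m)%N by rewrite expn_gt0 ltnW ?finNzRing_gt1.
by move=> x1; rewrite -(prednK q_gt0) exprS x1 mulr1.
Qed.

Lemma fixed_pow_pred m (x : L) : x != 0 ->
  x ^+ (#|F| ^ m) = x -> x ^+ (#|F| ^ m).-1 = 1.
Proof.
have q_gt0 : (0 < #|F| ^ m)%N by rewrite expn_gt0 ltnW ?finNzRing_gt1.
by move=> x0 fx; apply: (mulfI x0); rewrite mulr1 -exprS prednK.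
Qed.

Lemma dvd_card_ext m : (m %| n)%N -> ((#|F| ^ m).-1 %| #|L|.-1)%N.
Proof.
by case/dvdnP => k Dn; rewrite cardL Dn mulnC expnM (predn_exp _ k) dvdn_mulr.
Qed.

(** An x in the subfield of degree m = n / d has norm a if and only if its norm y
    from degree m satisfies y^d = a; each such y in F is the norm of [geom q m]
    elements. *)
Lemma card_norm_fixed (a : {unit F}) d : (d %| n)%N ->
  fixed_by F n [set x : L | x ^+ geom #|F| n == iota (FinRing.uval a)] d
  = (nroots [set: {unit F}] d a * geom #|F| (n %/ d))%N.
Proof.
move=> d_n; set m := (n %/ d)%N; have Dn : n = (d * m)%N by rewrite mulnC divnK.
rewrite /fixed_by /nroots -/m.
apply: (card_fibers (h := fun x : L => x ^+ geom #|F| m) iota_unit_inj).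
  move=> x; rewrite !inE; apply: (iffP andP) => [[/eqP nx /eqP fx] | [v]].
    have x0 : x != 0.
      apply: contra_eq_neq nx => ->; rewrite expr0n gtn_eqF ?geom_gt0 //.
      rewrite eq_sym fmorph_eq0 -unitfE; exact: valP a.
    have [|v Dv] := @pow_pred_card (x ^+ geom #|F| m).
      by rewrite -exprM mulnC geom_pred fixed_pow_pred.
    exists v => //; rewrite !inE; apply/eqP/iota_unit_inj.
    by rewrite /= iota_unitX -nx Dn pow_norm_tower // Dv.
  rewrite !inE => /eqP Dv xv.
  have fx : x ^+ (#|F| ^ m) = x.
    by apply: fixed_pow; rewrite -geom_pred mulnC exprM xv unit_pow_pred_card.
  by rewrite fx eqxx {1}Dn pow_norm_tower // xv -iota_unitX Dv.
move=> v _; apply: card_pow_eq; last exact: unit_pow_pred_card.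
  have d_gt0 : (0 < d)%N := dvdn_gt0 n_gt0 d_n.
  by apply: geom_gt0; rewrite divn_gt0 // dvdn_leq.
by rewrite mulnC geom_pred dvd_card_ext // Dn dvdn_mull.
Qed.

End UnitsAndRoots.

Section UnitaryCount.

Variables (F : finFieldType) (s : nat) (U : {group {unit F}}).
Hypotheses (Dq : #|F| = (s ^ 2)%N) (cardU : #|U| = s.+1).

Lemma sqrt_card_gt1 : (1 < s)%N.
Proof. by have := finNzRing_gt1 F; rewrite Dq; case: s => [|[]]. Qed.

Lemma pred_card_square : #|F|.-1 = (s.+1 * s.-1)%N.
Proof.
by rewrite Dq; have := sqrt_card_gt1; case: s => // t _; rewrite expnS expn1; nia.
Qed.

(** U lies in the group of (s+1)-th roots of unity of F, of the same order. *)
Lemma unitary_groupE v : (v \in U) = (FinRing.uval v ^+ s.+1 == 1).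
Proof.
have sub : [set FinRing.uval v | v in U] \subset [set x : F | x ^+ s.+1 == 1].
  apply/subsetP => _ /imsetP[w Uw ->]; rewrite inE -cardU.
  by rewrite -[_ ^+ _]/(FinRing.uval w ^+ _) -FinRing.val_unitX expg_cardG.
have eqU : [set FinRing.uval v | v in U] = [set x : F | x ^+ s.+1 == 1].
  have card_roots : #|[set x : F | x ^+ s.+1 == 1]| = s.+1.
    by apply: (card_pow_eq (b := s.-1)); rewrite ?expr1n // pred_card_square.
  apply/eqP; rewrite eqEcard sub card_roots.
  by rewrite (card_imset (mem U) (@uval_inj F)) cardU leqnn.
by rewrite -(mem_imset (mem U) v (@uval_inj F)) eqU inE.
Qed.

Variables (L : finFieldType) (iota : {rmorphism F -> L}) (n : nat).
Hypotheses (odd_n : odd n) (cardL : #|L| = (#|F| ^ n)%N).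

(** As in [card_norm_fixed], with the norm restricted to the group x^(s^m + 1) = 1,
    where it is x^e for e = (s^m + 1)/(s + 1) because [geom s m] acts trivially on
    the (s+1)-th roots of unity. *)
Lemma card_unitary_norm_fixed (a : {unit F}) d : (d %| n)%N ->
  fixed_by F n [set x : L | (x ^+ (s ^ n).+1 == 1) &&
                            (x ^+ geom #|F| n == iota (FinRing.uval a))] d
  = (nroots U d a * ((s ^ (n %/ d)).+1 %/ s.+1))%N.
Proof.
move=> d_n; set m := (n %/ d)%N; have Dn : n = (d * m)%N by rewrite mulnC divnK.
have odd_m : odd m by move: odd_n; rewrite Dn oddM => /andP[].
have odd_d : odd d by move: odd_n; rewrite Dn oddM => /andP[].
have powqE k : (#|F| ^ k = s ^ (k * 2))%N by rewrite Dq -expnM mulnC.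
set e := ((s ^ m).+1 %/ s.+1)%N.
have De : (e * s.+1 = (s ^ m).+1)%N by rewrite divnK // dvdn_odd_power.
(* (q^m - 1)/(q - 1) is the product of (s^m + 1)/(s + 1) and (s^m - 1)/(s - 1). *)
have geomE : geom #|F| m = (e * geom s m)%N.
  apply/eqP; rewrite -(eqn_pmul2l (ltn0Sn s)) Dq geom_square geom_double -De.
  by rewrite mulnA [(s.+1 * e)%N]mulnC.
rewrite /fixed_by /nroots -/m.
have normE (x : L) : x ^+ (s ^ m).+1 = 1 -> x ^+ geom #|F| m = x ^+ e.
  by move=> xm; rewrite geomE exprM pow_geom_odd // -exprM De.
have fixE (x : L) : x ^+ (s ^ m).+1 = 1 -> x ^+ (#|F| ^ m) = x.
  move=> xm; have x0 : x != 0.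
    by apply: contra_eq_neq xm => ->; rewrite expr0n eq_sym oner_eq0.
  have xV : x ^+ (s ^ m) = x^-1 by apply: (mulfI x0); rewrite -exprS xm mulfV.
  by rewrite powqE muln2 -addnn expnD exprM xV exprVn xV invrK.
apply: (card_fibers (h := fun x : L => x ^+ e) (iota_unit_inj (iota := iota))).
  move=> x; rewrite !inE; apply: (iffP andP) => [[/andP[/eqP xn /eqP nx] /eqP fx] | [v]].
    have xm : x ^+ (s ^ m).+1 = 1.
      by rewrite exprS -(odd_iterated_power _ odd_d) -?powqE // -Dn -exprS.
    have [|v Dv] := @pow_pred_card F L iota (x ^+ e).
      by rewrite pred_card_square exprM -(exprM x e) De xm expr1n.
    exists v => //; rewrite !inE unitary_groupE; apply/andP; split.
      by rewrite -(fmorph_eq1 iota) rmorphXn -Dv -exprM De xm.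
    apply/eqP/(iota_unit_inj (iota := iota)).
    by rewrite /= iota_unitX -nx Dn pow_norm_tower // normE // Dv.
  rewrite !inE unitary_groupE => /andP[/eqP v1 /eqP Dv] xv.
  have xm : x ^+ (s ^ m).+1 = 1 by rewrite -De exprM xv -rmorphXn v1 rmorph1.
  have fx := fixE x xm.
  rewrite fx eqxx {2}Dn pow_norm_tower // normE // xv -iota_unitX Dv eqxx andbT.
  by rewrite exprS Dn (odd_iterated_power _ odd_d) -?powqE // -exprS xm eqxx.
move=> v; rewrite inE unitary_groupE => /andP[/eqP v1 _].
apply: (card_pow_eq (b := s.+1)).
- by rewrite -(ltn_pmul2r (ltn0Sn s)) De mul0n.
- have m_n : (m %| n)%N by rewrite Dn dvdn_mull.
  rewrite De; apply: dvdn_trans (dvd_card_ext cardL m_n).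
  by rewrite -geom_pred geomE pred_card_square mulnACA [(s.+1 * e)%N]mulnC De dvdn_mulr.
- by rewrite -rmorphXn v1 rmorph1.
Qed.

End UnitaryCount.

Section StarCount.

Variables (F L : finFieldType) (iota : {rmorphism F -> L}) (n : nat).
Hypotheses (n_gt0 : (0 < n)%N) (cardL : #|L| = (#|F| ^ (2 * n))%N).

(** The elements 1 and -1 are removed: they satisfy x^(q^n + 1) = 1 and would
    otherwise contribute to the terms of even d and to the error term. *)
Definition star_roots := [set x : L | (x ^+ (#|F| ^ n).+1 == 1) && (x ^+ 2 != 1)].

Lemma square_roots_of_1_even : ~~ odd #|F| -> [set x : L | x ^+ 2 == 1] = [set 1].
Proof.
move=> even_q; have p2 : [pchar L].-nat 2.
  by apply: pnat_dvd (pnat_card_ext iota); rewrite dvdn2.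
apply/setP => x; rewrite !inE.
by rewrite -{1}[1](expr1n _ 2) (inj_eq (pchar_power_inj p2)).
Qed.

Lemma card_square_roots_of_1 : #|[set x : L | x ^+ 2 == 1]| = (odd #|F|).+1.
Proof.
have [odd_q | even_q] := boolP (odd #|F|); last first.
  by rewrite square_roots_of_1_even // cards1.
apply: (card_pow_eq (b := 1)) => //; rewrite muln1 cardL dvdn2.
have := oddX #|F| (2 * n); rewrite odd_q orbT; case: (_ ^ _)%N => //= k.
Qed.

(** For even d the subfield is contained in the one of degree n, where
    x^-1 = x^(q^n) = x.  For odd d the equation x^(q^n + 1) = 1 reduces on the
    subfield of degree 2m, with m = n / d, to x^(q^m + 1) = 1. *)
Lemma card_star_roots_fixed d : (d %| 2 * n)%N ->
  fixed_by F (2 * n) star_roots d =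
  if odd d then (#|F| ^ (n %/ d) - odd #|F|)%N else 0%N.
Proof.
move=> d_n; rewrite /fixed_by; case: ifPn => [odd_d | even_d].
  have dn : (d %| n)%N by move: d_n; rewrite Gauss_dvdr // coprimen2.
  set m := (n %/ d)%N; have Dn : n = (d * m)%N by rewrite mulnC divnK.
  have d_gt0 : (0 < d)%N := dvdn_gt0 n_gt0 dn.
  have m_gt0 : (0 < m)%N by rewrite divn_gt0 // dvdn_leq.
  have -> : (2 * n %/ d = m * 2)%N by rewrite -muln_divA // mulnC.
  have q_gt0 := ltnW (finNzRing_gt1 F).
  have sub2 : [set x : L | x ^+ 2 == 1] \subset [set x : L | x ^+ (#|F| ^ m).+1 == 1].
    apply/subsetP => x; rewrite !inE => /eqP x2.
    have [odd_q | even_q] := boolP (odd #|F|).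
      have /dvdnP[k ->] : (2 %| (#|F| ^ m).+1)%N by rewrite dvdn2 /= oddX odd_q orbT.
      by rewrite mulnC exprM x2 expr1n.
    have : x \in [set x : L | x ^+ 2 == 1] by rewrite inE x2.
    by rewrite square_roots_of_1_even // inE => /eqP ->; rewrite expr1n.
  have card_m : #|[set x : L | x ^+ (#|F| ^ m).+1 == 1]| = (#|F| ^ m).+1.
    apply: (card_pow_eq (b := (#|F| ^ m).-1)); rewrite ?expr1n // cardL Dn.
    have -> : ((#|F| ^ m).+1 * (#|F| ^ m).-1 = (#|F| ^ (m * 2)).-1)%N.
      rewrite expnM; case: (#|F| ^ m)%N (expn_gt0 #|F| m) => [|k _].
        by rewrite q_gt0.
      by rewrite expnS expn1; nia.
    have -> : (2 * (d * m) = m * 2 * d)%N by lia.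
    by rewrite [X in (_ %| X.-1)%N]expnM (predn_exp _ d) dvdn_mulr.
  have -> : [set x in star_roots | x ^+ (#|F| ^ (m * 2)) == x]
      = [set x : L | x ^+ (#|F| ^ m).+1 == 1] :\: [set x : L | x ^+ 2 == 1].
    apply/setP => x; rewrite !inE andbC; case x2: (x ^+ 2 == 1); rewrite ?andbF //= andbT.
    apply/andP/eqP => [[/eqP fx /eqP xn] | xm].
      by rewrite exprS -(odd_iterated_power fx odd_d) -Dn -exprS.
    have x0 : x != 0.
      by apply: contra_eq_neq xm => ->; rewrite expr0n eq_sym oner_eq0.
    have xV : x ^+ (#|F| ^ m) = x^-1 by apply: (mulfI x0); rewrite -exprS xm mulfV.
    have fx : x ^+ (#|F| ^ (m * 2)) = x.
      by rewrite muln2 -addnn expnD exprM xV exprVn xV invrK.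
    by rewrite fx eqxx exprS Dn (odd_iterated_power fx odd_d) -exprS xm eqxx.
  rewrite cardsD (setIidPr sub2) card_m card_square_roots_of_1.
  by case: (odd _); rewrite ?subn1 ?subn2 ?subn0.
apply: eq_card0 => x; rewrite !inE; apply/andP => -[/andP[/eqP xn x2] /eqP fx].
have [k Dk] : exists k, (n = k * (2 * n %/ d))%N.
  exists d./2; have Dd : (d = d./2.*2)%N by rewrite -{1}[d]odd_double_half (negPf even_d).
  by move: (divnK d_n) Dd; move: (2 * n %/ d)%N d./2 => w h; nia.
have xqn : x ^+ (#|F| ^ n) = x.
  rewrite Dk; elim: (k) => [|j IHj]; first by rewrite mul0n expr1.
  by rewrite mulSn expnD exprM fx.
by case/eqP: x2; rewrite -[RHS]xn expr2 [RHS]exprS xqn.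
Qed.

End StarCount.

(** * Counting irreducible polynomials *)

Section Roots.

Variable F : finFieldType.

Lemma nroots1 (G : {set {unit F}}) a : a \in G -> nroots G 1 a = 1%N.
Proof.
move=> Ga; transitivity #|[set a]|; last exact: cards1.
apply: eq_card => x; rewrite !inE expg1.
by case: eqVneq => [->|_]; rewrite ?Ga ?andbF.
Qed.

Lemma nroots_le_deg (G : {set {unit F}}) d a : (0 < d)%N -> (nroots G d a <= d)%N.
Proof.
move=> d_gt0; pose s := [seq FinRing.uval v | v in [set x in G | (x ^+ d == a)%g]].
have szs : size s = nroots G d a by rewrite size_map -cardE.
have p0 : 'X^d - (FinRing.uval a)%:P != 0 by rewrite -size_poly_gt0 size_XnsubC.
rewrite -szs -ltnS -(size_XnsubC (FinRing.uval a) d_gt0); apply: max_poly_roots => //.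
  apply/allP => _ /mapP[v + ->]; rewrite mem_enum inE => /andP[_ /eqP <-].
  rewrite rootE !hornerE subr_eq0 -[X in _ == X]/(FinRing.uval _) FinRing.val_unitX.
  exact: eqxx.
by rewrite map_inj_uniq ?enum_uniq //; apply: uval_inj.
Qed.

Lemma nroots_le_card (G : {set {unit F}}) d a : (nroots G d a <= #|F|.-1)%N.
Proof. by rewrite -card_finField_unit cardsT; apply: max_card. Qed.

End Roots.

Section SieveCount.

Variables (F L : finFieldType) (iota : {rmorphism F -> L}) (n : nat).
Hypotheses (n_gt0 : (0 < n)%N) (cardL : #|L| = (#|F| ^ n)%N).
Variables (A : {set L}) (P : pred {poly F}).
Hypothesis PA : forall f x, f \is monic -> irreducible_poly f -> fdeg F x = n ->
  root (map_poly iota f) x -> P f = (x \in A).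

Lemma num_irred_sieve :
  [/\ (num_irred n P * n)%:Z
        = \sum_(d <- divisors n) mobius d * (fixed_by F n A d)%:Z,
      (num_irred n P * n <= fixed_by F n A 1)%N
    & (fixed_by F n A 1 <= num_irred n P * n
         + \sum_(p <- primes n) fixed_by F n A p)%N].
Proof.
have -> : fixed_by F n A 1 = #|A|.
  apply: eq_card => x; rewrite inE divn1 -cardL expf_card eqxx andbT //.
have -> : (num_irred n P * n)%N = #|[set x in A | fdeg F x == n]|.
  rewrite (num_irred_fdeg (iota := iota) cardL (Q := mem A)).
    by apply: eq_card => x; rewrite !inE andbC.
  move=> f x fmon firr szf fx; apply: PA => //.
  by have := fdeg_irreducible_root fmon firr fx; rewrite szf => -[].
split; [exact: card_fdeg_mobius | exact: card_fdeg_le | exact: card_fdeg_ge].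
Qed.

End SieveCount.

Section Counts.

Variable F : finFieldType.

Lemma pi_q_sieve (n : nat) (a : {unit F}) : (0 < n)%N ->
  let c d := (nroots [set: {unit F}] d a * geom #|F| (n %/ d))%N in
  let N := (pi_q n ((-1) ^+ n * FinRing.uval a)%R * n)%N in
  [/\ N%:Z = \sum_(d <- divisors n) mobius d * (c d)%:Z,
      (N <= geom #|F| n)%N & (geom #|F| n <= N + \sum_(p <- primes n) c p)%N].
Proof.
move=> n_gt0 c N; have [L [iota cardL]] := finField_extension F n_gt0.
pose A := [set x : L | x ^+ geom #|F| n == iota (FinRing.uval a)].
have cE d : (d %| n)%N -> fixed_by F n A d = c d.
  by move=> dn; rewrite (card_norm_fixed iota n_gt0 cardL).
have c1 : c 1%N = geom #|F| n by rewrite /c nroots1 ?inE // mul1n divn1.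
have PA f x : f \is monic -> irreducible_poly f -> fdeg F x = n ->
    root (map_poly iota f) x -> (f`_0 == (-1) ^+ n * FinRing.uval a) = (x \in A).
  move=> fmon firr Dn fx; rewrite inE -(inj_eq (fmorph_inj iota)).
  rewrite (coef0_norm fmon firr fx) Dn rmorphM rmorphXn rmorphN1.
  by rewrite (inj_eq (mulfI _)) // signr_eq0.
have [E lo hi] := num_irred_sieve n_gt0 cardL PA.
rewrite -c1 -cE ?dvd1n //; split=> //.
  rewrite E !big_seq; apply: eq_bigr => d; rewrite -dvdn_divisors // => dn.
  by rewrite cE.
rewrite (leq_trans hi) // leq_add2l big_seq [leqRHS]big_seq leq_sum // => p.
by rewrite mem_primes => /and3P[_ _ pn]; rewrite cE.
Qed.

(** The terms of even d vanish, so the sums over the divisors of 2n become sums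
    over the odd divisors of n. *)
Lemma pi_star_sieve (n : nat) : (0 < n)%N ->
  let c d := (#|F| ^ (n %/ d) - odd #|F|)%N in
  let N := (pi_star F (2 * n) * (2 * n))%N in
  [/\ N%:Z = \sum_(d <- divisors n | odd d) mobius d * (c d)%:Z,
      (N <= c 1)%N & (c 1 <= N + \sum_(p <- primes n | odd p) c p)%N].
Proof.
move=> n_gt0 c N; have n2_gt0 : (0 < 2 * n)%N by rewrite muln_gt0.
have [L [iota cardL]] := finField_extension F n2_gt0.
pose A := star_roots F L n.
have cE d : (d %| 2 * n)%N -> fixed_by F (2 * n) A d = if odd d then c d else 0%N.
  exact: (card_star_roots_fixed iota n_gt0 cardL).
have PA f x : f \is monic -> irreducible_poly f -> fdeg F x = (2 * n)%N ->
    root (map_poly iota f) x -> star_symmetric f = (x \in A).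
  move=> fmon firr Dn fx; rewrite star_dagger (dagger_symmetric_root fmon firr fx) //.
  rewrite expr1 inE; have x2 : x ^+ 2 != 1.
    apply/eqP => /eqP; rewrite sqrf_eq1 => x1.
    have : (fdeg F x %| 1)%N.
      rewrite -(fdeg_dvdP iota) expn1; case/orP: x1 => /eqP->; rewrite ?expr1n //.
      by rewrite (power_mapN1 (pnat_card_ext iota)).
    by rewrite Dn dvdn1; lia.
  rewrite x2 andbT; apply/andP/eqP => [[x0] | xn].
    case/(root_irreducibleP fmon firr fx) => i lt_i xi.
    case: (inv_conjugate_fdeg iota x0 lt_i xi) => [/eqP | ]; first by rewrite (negPf x2).
    rewrite Dn mulnC => /eqP; rewrite eqn_pmul2r // => /eqP ni.
    by rewrite exprS ni -xi mulfV.
  have x0 : x != 0.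
    by apply: contra_eq_neq xn => ->; rewrite expr0n eq_sym oner_eq0.
  split=> //; suff -> : x^-1 = x ^+ (#|F| ^ n) by apply: root_frob_pow.
  by apply: (mulfI x0); rewrite -exprS xn mulfV.
have [E lo hi] := num_irred_sieve n2_gt0 cardL PA.
have c1 := cE 1%N (dvd1n _); rewrite /= in c1.
rewrite -c1; split=> //.
  rewrite E (bigID odd) /= [X in _ + X]big1_seq ?addr0; last first.
    move=> d /andP[/negPf even_d]; rewrite -dvdn_divisors // => dn.
    by rewrite cE // even_d mulr0.
  rewrite -big_filter -[RHS]big_filter (perm_big [seq d <- divisors n | odd d]).
    rewrite !big_seq; apply: eq_bigr => d; rewrite mem_filter -dvdn_divisors //.
    by case/andP=> odd_d dn; rewrite cE ?odd_d // dvdn_mull.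
  apply: uniq_perm; rewrite ?filter_uniq ?divisors_uniq // => d.
  rewrite !mem_filter -!dvdn_divisors //; case odd_d: (odd d) => //=.
  by rewrite Gauss_dvdr // coprimen2.
rewrite (leq_trans hi) // leq_add2l (bigID odd) /=.
rewrite [X in (_ + X)%N]big1_seq ?addn0; last first.
  move=> p /andP[/negPf even_p]; rewrite mem_primes => /and3P[_ _ pn].
  by rewrite cE // even_p.
rewrite -big_filter -[leqRHS]big_filter (perm_big [seq p <- primes n | odd p]).
  rewrite big_seq [leqRHS]big_seq leq_sum // => p; rewrite mem_filter mem_primes.
  by case/and4P=> odd_p _ _ pn; rewrite cE ?odd_p // dvdn_mull.
apply: uniq_perm; rewrite ?filter_uniq ?primes_uniq // => p.
rewrite !mem_filter !mem_primes n2_gt0 n_gt0; case odd_p: (odd p) => //=.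
by rewrite Gauss_dvdr // coprimen2.
Qed.

Lemma pi_dagger_sieve (s n : nat) (U : {group {unit F}}) (a : {unit F}) :
  #|F| = (s ^ 2)%N -> #|U| = s.+1 -> odd n -> a \in U ->
  let c d := (nroots U d a * ((s ^ (n %/ d)).+1 %/ s.+1))%N in
  let N := (pi_dagger s n (- FinRing.uval a)%R * n)%N in
  [/\ N%:Z = \sum_(d <- divisors n) mobius d * (c d)%:Z,
      (N <= c 1)%N & (c 1 <= N + \sum_(p <- primes n) c p)%N].
Proof.
move=> Dq cardU odd_n Ua c N; have n_gt0 := odd_gt0 odd_n.
have [L [iota cardL]] := finField_extension F n_gt0.
pose A := [set x : L | (x ^+ (s ^ n).+1 == 1) &&
                       (x ^+ geom #|F| n == iota (FinRing.uval a))].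
have cE d : (d %| n)%N -> fixed_by F n A d = c d.
  by move=> dn; rewrite (card_unitary_norm_fixed Dq cardU iota odd_n cardL).
have PA f x : f \is monic -> irreducible_poly f -> fdeg F x = n ->
    root (map_poly iota f) x ->
    dagger_symmetric s f && (f`_0 == - FinRing.uval a) = (x \in A).
  move=> fmon firr Dn fx; rewrite inE -(inj_eq (fmorph_inj iota)).
  rewrite (coef0_norm fmon firr fx) Dn -signr_odd odd_n mulN1r rmorphN.
  rewrite (inj_eq oppr_inj).
  rewrite (dagger_symmetric_root fmon firr fx (pchar_nat_sqrt Dq)).
  case: eqVneq => [x0 | x0] /=; first by rewrite x0 expr0n eq_sym oner_eq0.
  by rewrite (dagger_root_odd fmon firr fx) // Dn odd_n.
have [E lo hi] := num_irred_sieve n_gt0 cardL PA.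
rewrite -cE ?dvd1n //; split=> //.
  rewrite E !big_seq; apply: eq_bigr => d; rewrite -dvdn_divisors // => dn.
  by rewrite cE.
rewrite (leq_trans hi) // leq_add2l big_seq [leqRHS]big_seq leq_sum // => p.
by rewrite mem_primes => /and3P[_ _ pn]; rewrite cE.
Qed.

End Counts.

(** * Size of the error terms *)

Section Estimates.

Variable R : realType.

(** The right-hand side is the sum of the infinite series; the proof computes the
    remainder, which is nonnegative. *)
Lemma arith_geom_sum (a b w : R) K : 0 <= w < 1 -> 0 <= a -> 0 <= b ->
  \sum_(k < K) (a * k%:R + b) * w ^+ k <= b / (1 - w) + a * w / (1 - w) ^+ 2.
Proof.
case/andP=> w_ge0 w_lt1 a_ge0 b_ge0; have v_gt0 : 0 < 1 - w by rewrite subr_gt0.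
have v0 : 1 - w != 0 by rewrite gt_eqF.
suff E : \sum_(k < K) (a * k%:R + b) * w ^+ k
    = b / (1 - w) + a * w / (1 - w) ^+ 2
      - w ^+ K * ((a * K%:R + b) / (1 - w) + a * w / (1 - w) ^+ 2).
  rewrite E gerBl mulr_ge0 ?exprn_ge0 //.
  by apply: addr_ge0; apply: divr_ge0;
    rewrite ?exprn_ge0 ?(ltW v_gt0) ?addr_ge0 ?mulr_ge0.
elim: K => [|K IHK]; first by rewrite big_ord0 expr0; field.
by rewrite big_ord_recr /= IHK [w ^+ K.+1]exprS -[K.+1%:R]natr1; field.
Qed.

Lemma ler_sum_uniq_nat (g : nat -> R) (l : seq nat) K :
  (forall k, 0 <= g k) -> uniq l -> {in l, forall k, (k < K)%N} ->
  \sum_(k <- l) g k <= \sum_(k < K) g k.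
Proof.
move=> g_ge0 uniq_l lK; rewrite -(big_mkord xpredT g) [leRHS](bigID (mem l)) /=.
have -> : \sum_(k <- l) g k = \sum_(0 <= k < K | k \in l) g k.
  rewrite -[RHS]big_filter; apply: perm_big.
  apply: uniq_perm; rewrite ?filter_uniq ?iota_uniq // => k.
  rewrite mem_filter mem_index_iota /=; case kl: (k \in l) => //=.
  by rewrite lK.
by rewrite lerDl sumr_ge0.
Qed.

Lemma sum_primes_le (r : seq nat) (g : nat -> R) (h : nat -> nat) n :
  (forall k, 0 <= g k) -> uniq r -> {in r &, injective h} ->
  {in r, forall p, (h p < n)%N} ->
  \sum_(p <- r) g (h p) <= \sum_(k < n) g k.
Proof.
move=> g_ge0 uniq_r h_inj hn; rewrite -(big_map h xpredT).
apply: ler_sum_uniq_nat; rewrite ?map_inj_in_uniq // => _ /mapP[p rp ->].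
exact: hn.
Qed.

(** With k = n / p >= 1, the inequality of exponents k <= (kp - (p - c))/c amounts
    to (k - 1)(p - c) >= 0. *)
Lemma powR_prime_quotient (b c p n : nat) : (1 < b)%N -> (0 < c)%N ->
  (c <= p)%N -> (0 < n)%N -> (p %| n)%N ->
  b%:R ^+ (n %/ p) <= b%:R `^ (n%:R / c%:R) * (b%:R `^ (- c%:R^-1)) ^+ (p - c) :> R.
Proof.
move=> b_gt1 c_gt0 le_cp n_gt0 p_n; have b_ge1 : 1 <= b%:R :> R by rewrite ler1n ltnW.
have b_gt0 : 0 < b%:R :> R by rewrite ltr0n ltnW.
have c0 : 0 < c%:R :> R by rewrite ltr0n.
rewrite -!powR_mulrn ?powR_ge0 ?(ltW b_gt0) // -powRrM -powRD; last first.
  by apply/implyP => _; rewrite gt_eqF.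
apply: ler_powR => //; set k := (n %/ p)%N.
have p_gt0 : (0 < p)%N := dvdn_gt0 n_gt0 p_n.
have k_gt0 : (0 < k)%N by rewrite divn_gt0 // dvdn_leq.
have -> : n%:R = k%:R * p%:R :> R by rewrite -natrM divnK.
rewrite natrB // -subr_ge0.
rewrite (_ : _ - _ = (k%:R - 1) * (p%:R - c%:R) / c%:R); last first.
  by field; rewrite gt_eqF.
by rewrite divr_ge0 ?(ltW c0) // mulr_ge0 // subr_ge0 ?ler1n ?ler_nat.
Qed.

Lemma exists_error_term (N X Y M C : R) : 0 < M -> Y != 0 ->
  0 <= X - N * Y <= C * M ->
  exists eps : R, 0 <= eps <= C /\ N = (X - eps * M) / Y.
Proof.
move=> M_gt0 Y0 /andP[lo hi]; exists ((X - N * Y) / M).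
rewrite divr_ge0 ?(ltW M_gt0) // ler_pdivrMr // hi; split=> //.
have M0 : M != 0 by rewrite gt_eqF.
by field; rewrite M0 Y0.
Qed.

Lemma powRV_exprn (b c : nat) : (0 < b)%N -> (0 < c)%N ->
  (b%:R `^ (- c%:R^-1)) ^+ c = b%:R^-1 :> R.
Proof.
move=> b_gt0 c_gt0; rewrite -powR_mulrn ?powR_ge0 // -powRrM mulNr mulVf.
  by rewrite powRN powRr1 ?ler0n.
by rewrite pnatr_eq0 -lt0n.
Qed.

(** The primes p in l are spaced as c + e * h p, so by [powR_prime_quotient] the
    sum is at most b^(n/c) times the series of (alpha * k + beta) * (y^e)^k, where
    y = b^(-1/c).  The number w is an upper bound of y^e; this is stated
    as 1 <= w^c * b^e, free of real powers. *)
Lemma prime_sum_bound (b c e n : nat) (l : seq nat) (h : nat -> nat)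
    (u : nat -> R) (alpha beta w C : R) :
  (1 < b)%N -> (0 < c)%N -> (0 < n)%N ->
  uniq l -> {in l, forall p, [/\ (p %| n)%N, p = (c + e * h p)%N & (h p < n)%N]} ->
  0 <= alpha -> 0 <= beta -> {in l, forall p, u p <= alpha * (h p)%:R + beta} ->
  0 <= w < 1 -> 1 <= w ^+ c * b%:R ^+ e ->
  beta * (1 - w) + alpha * w <= C * (1 - w) ^+ 2 ->
  \sum_(p <- l) u p * b%:R ^+ (n %/ p) <= C * b%:R `^ (n%:R / c%:R).
Proof.
move=> b_gt1 c_gt0 n_gt0 uniq_l lP alpha_ge0 beta_ge0 u_le w01 w_ge C_ge.
have /andP[w_ge0 w_lt1] := w01; have b_gt0 : (0 < b)%N by apply: ltnW.
have bR_gt0 : 0 < b%:R :> R by rewrite ltr0n.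
set M := _ `^ _; have M_ge0 : 0 <= M by apply: powR_ge0.
pose y : R := b%:R `^ (- c%:R^-1); have y_ge0 : 0 <= y by apply: powR_ge0.
have yw : y ^+ e <= w.
  rewrite -(@ler_pXn2r _ c) ?nnegrE ?exprn_ge0 // -exprM mulnC exprM.
  by rewrite powRV_exprn // exprVn -div1r ler_pdivrMr ?exprn_gt0.
pose g k : R := (alpha * k%:R + beta) * w ^+ k.
have g_ge0 k : 0 <= g k by rewrite mulr_ge0 ?exprn_ge0 ?addr_ge0 ?mulr_ge0.
have h_inj : {in l &, injective h}.
  by move=> p r /lP[_ Dp _] /lP[_ Dr _] hpr; rewrite Dp Dr hpr.
have step : \sum_(p <- l) u p * b%:R ^+ (n %/ p) <= \sum_(p <- l) g (h p) * M.
  rewrite big_seq [leRHS]big_seq; apply: ler_sum => p lp.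
  have [pn Dp _] := lP p lp.
  have le_cp : (c <= p)%N by rewrite Dp leq_addr.
  have wt_ge0 : 0 <= alpha * (h p)%:R + beta by rewrite addr_ge0 ?mulr_ge0.
  apply: le_trans (_ : (alpha * (h p)%:R + beta) * b%:R ^+ (n %/ p) <= _).
    by rewrite ler_wpM2r ?exprn_ge0 ?(ltW bR_gt0) ?u_le.
  rewrite /g -mulrA ler_wpM2l // mulrC.
  apply: le_trans (powR_prime_quotient b_gt1 c_gt0 le_cp n_gt0 pn) _.
  rewrite ler_wpM2l // {1}Dp addKn exprM -/y.
  by rewrite lerXn2r ?nnegrE ?exprn_ge0.
apply: le_trans step _; rewrite -mulr_suml ler_wpM2r //.
apply: le_trans (_ : beta / (1 - w) + alpha * w / (1 - w) ^+ 2 <= C); last first.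
  have v_gt0 : 0 < 1 - w by rewrite subr_gt0.
  rewrite -(@ler_pM2r _ ((1 - w) ^+ 2)) ?exprn_gt0 //.
  apply: le_trans C_ge; rewrite le_eqVlt; apply/orP; left; apply/eqP.
  by field; rewrite gt_eqF.
apply: le_trans (arith_geom_sum n w01 alpha_ge0 beta_ge0).
by apply: sum_primes_le => // p /lP[].
Qed.

Lemma primes_offset (n c e : nat) (h : nat -> nat) (l : seq nat) :
  (0 < n)%N -> {subset l <= primes n} -> (0 < c)%N -> (0 < e)%N ->
  {in l, forall p, p = (c + e * h p)%N} ->
  {in l, forall p, [/\ (p %| n)%N, p = (c + e * h p)%N & (h p < n)%N]}.
Proof.
move=> n_gt0 sub_l c_gt0 e_gt0 lh p lp; have Dp := lh p lp.
have := sub_l p lp; rewrite mem_primes => /and3P[_ _ pn]; split=> //.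
apply: leq_trans (dvdn_leq n_gt0 pn).
by rewrite [X in (_ < X)%N]Dp -add1n leq_add // leq_pmull.
Qed.

(** The bound r p <= p gives less than 9 for q >= 3, but too much for q = 2, where
    instead r p <= 1. *)
Lemma norm_error_bound (q n : nat) (r : nat -> nat) :
  (1 < q)%N -> (0 < n)%N -> (forall p, (0 < p)%N -> (r p <= p)%N) ->
  (forall p, (r p <= q.-1)%N) ->
  \sum_(p <- primes n) (r p)%:R * q%:R ^+ (n %/ p) <= 10 * q%:R `^ (n%:R / 2) :> R.
Proof.
move=> q_gt1 n_gt0 r_deg r_card.
have lP : {in primes n, forall p,
    [/\ (p %| n)%N, p = (2 + 1 * (p - 2))%N & (p - 2 < n)%N]}.
  apply: (@primes_offset n 2 1 (fun p => p - 2)%N) => // p.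
  by rewrite mem_primes => /andP[/prime_gt1]; lia.
have [q2 | q_gt2] : q = 2%N \/ (2 < q)%N by lia.
  (* 2^(-1/2) < 3/4 *)
  apply: (prime_sum_bound (c := 2) (alpha := 0) (beta := 1) (w := 3 / 4)
    q_gt1 isT n_gt0 (primes_uniq n) lP _ _ _ _ _ _) => //.
  - by move=> p _; rewrite mul0r add0r lern1; have := r_card p; rewrite q2; lia.
  - by lra.
  - by rewrite q2 expr1; lra.
  - by lra.
(* 3^(-1/2) < 3/5 *)
apply: (prime_sum_bound (c := 2) (alpha := 1) (beta := 2) (w := 3 / 5)
  q_gt1 isT n_gt0 (primes_uniq n) lP _ _ _ _ _ _) => //.
- move=> p /[dup] /lP[_ Dp _]; rewrite mem_primes => /andP[/prime_gt0 p_gt0 _].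
  by rewrite mul1r -natrD ler_nat; have := r_deg p p_gt0; lia.
- by lra.
- by have q_ge3 : 3 <= q%:R :> R; [rewrite ler_nat | rewrite expr1; lra].
- by lra.
Qed.

Lemma odd_primes_offset n : (0 < n)%N ->
  {in [seq p <- primes n | odd p], forall p,
     [/\ (p %| n)%N, p = (3 + 2 * (p - 3)./2)%N & ((p - 3)./2 < n)%N]}.
Proof.
move=> n_gt0; apply: (@primes_offset n 3 2 (fun p => (p - 3)./2)) => // p.
  by rewrite mem_filter => /andP[].
rewrite mem_filter mem_primes => /and4P[odd_p /prime_gt1 p_gt1 _ _].
have p_gt2 : (2 < p)%N by case: p odd_p p_gt1 => [|[|[|]]].
have := odd_double_half (p - 3); rewrite oddB // odd_p /=; lia.
Qed.

(** For q = 2 the parity term vanishes and the series is at most 1/(1 - 16/25) < 3;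
    for q >= 3 it is at most 2, which leaves room for the parity term. *)
Lemma star_error_bound (q n : nat) : (1 < q)%N -> (0 < n)%N ->
  (odd q)%:R + \sum_(p <- primes n | odd p) q%:R ^+ (n %/ p)
    <= 3 * q%:R `^ (n%:R / 3) :> R.
Proof.
move=> q_gt1 n_gt0.
have M_ge1 : 1 <= q%:R `^ (n%:R / 3) :> R.
  apply: le_trans (_ : q%:R `^ 0 <= _); first by rewrite powRr0.
  by apply: ler_powR; rewrite ?ler1n ?(ltnW q_gt1) ?divr_ge0.
have u1 : \sum_(p <- primes n | odd p) q%:R ^+ (n %/ p)
    = \sum_(p <- [seq p <- primes n | odd p]) 1 * q%:R ^+ (n %/ p) :> R.
  by rewrite big_filter; apply: eq_bigr => p _; rewrite mul1r.
rewrite u1; have uniq_l := filter_uniq odd (primes_uniq n).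
have [q2 | q_gt2] : q = 2%N \/ (2 < q)%N by lia.
  rewrite {1}q2 add0r.
  (* 2^(-2/3) < 16/25 *)
  apply: (prime_sum_bound (c := 3) (alpha := 0) (beta := 1) (w := 16 / 25)
    q_gt1 isT n_gt0 uniq_l (odd_primes_offset n_gt0) _ _ _ _ _ _) => //.
  - by move=> p _; rewrite mul0r add0r.
  - by lra.
  - by rewrite q2; lra.
  - by lra.
have -> : 3 * q%:R `^ (n%:R / 3) = q%:R `^ (n%:R / 3) + 2 * q%:R `^ (n%:R / 3) :> R.
  by ring.
apply: lerD; first by apply: le_trans M_ge1; case: (odd q).
(* 3^(-2/3) < 1/2 *)
apply: (prime_sum_bound (c := 3) (alpha := 0) (beta := 1) (w := 1 / 2)
    q_gt1 isT n_gt0 uniq_l (odd_primes_offset n_gt0) _ _ _ _ _ _) => //.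
- by move=> p _; rewrite mul0r add0r.
- by lra.
- by have q_ge3 : 3 <= q%:R :> R; [rewrite ler_nat | nra].
- by lra.
Qed.

(** Since s^(n/p) >= 2, the added 1 costs at most a factor 3/2; the weights are
    then 3/2 * p = 3k + 9/2 for p = 3 + 2k. *)
Lemma unitary_error_bound (s n : nat) (r : nat -> nat) :
  (1 < s)%N -> odd n -> (forall p, (0 < p)%N -> (r p <= p)%N) ->
  \sum_(p <- primes n) (r p)%:R * (s%:R ^+ (n %/ p) + 1)
    <= 40 * s%:R `^ (n%:R / 3) :> R.
Proof.
move=> s_gt1 odd_n r_deg; have n_gt0 := odd_gt0 odd_n.
have odd_l : [seq p <- primes n | odd p] = primes n.
  apply/all_filterP/allP => p; rewrite mem_primes => /and3P[_ _ pn].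
  exact: dvdn_odd pn odd_n.
have uniq_l := primes_uniq n; have lP := odd_primes_offset n_gt0; rewrite odd_l in lP.
have s_ge2 : 2 <= s%:R :> R by rewrite ler_nat.
apply: le_trans (_ : \sum_(p <- primes n) (3 / 2 * p%:R) * s%:R ^+ (n %/ p) <= _).
  rewrite big_seq [leRHS]big_seq; apply: ler_sum => p.
  rewrite mem_primes => /and3P[/prime_gt0 p_gt0 _ pn].
  have sk_ge2 : 2 <= s%:R ^+ (n %/ p) :> R.
    have k_gt0 : (0 < n %/ p)%N by rewrite divn_gt0 // dvdn_leq.
    apply: le_trans (_ : s%:R ^+ 1 <= _); first by rewrite expr1.
    by apply: ler_weXn2l => //; lra.
  have rp : (r p)%:R <= p%:R :> R by rewrite ler_nat r_deg.
  apply: le_trans (_ : p%:R * (s%:R ^+ (n %/ p) + 1) <= _).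
    by rewrite ler_wpM2r //; lra.
  by rewrite -[leRHS]mulrA mulrCA ler_wpM2l //; lra.
(* 2^(-2/3) < 16/25 *)
apply: (prime_sum_bound (c := 3) (alpha := 3) (beta := 9 / 2) (w := 16 / 25)
    s_gt1 isT n_gt0 uniq_l lP _ _ _ _ _ _) => //.
- by lra.
- move=> p lp; have [_ Dp _] := lP p lp.
  have : p%:R = 3 + 2 * ((p - 3)./2)%:R :> R by rewrite {1}Dp natrD natrM.
  by lra.
- by lra.
- by nra.
- by lra.
Qed.

End Estimates.

(** * The three counting formulas *)

Section Formulas.

Variable R : realType.

Lemma geom_natr (b m : nat) : (1 < b)%N ->
  (geom b m)%:R = (b%:R ^+ m - 1) / (b%:R - 1) :> R.
Proof.
move=> b_gt1; have b1 : b%:R - 1 != 0 :> R by rewrite subr_eq0 pnatr_eq1 gtn_eqF.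
apply: (mulIf b1); rewrite divfK // subrX1 mulrC /geom natr_sum.
by congr (_ * _); apply: eq_bigr => i _; rewrite natrX.
Qed.

Lemma odd_power_quotient_natr (s m : nat) : odd m ->
  ((s ^ m).+1 %/ s.+1)%:R = (s%:R ^+ m + 1) / (s%:R + 1) :> R.
Proof.
move=> odd_m; have s1 : s%:R + 1 != 0 :> R by rewrite natr1 pnatr_eq0.
apply: (mulIf s1); rewrite divfK // natr1 -natrM divnK ?dvdn_odd_power //.
by rewrite -natr1 natrX.
Qed.

Lemma mobius_sum_natr (N : nat) (l : seq nat) (P : pred nat) (c : nat -> nat) :
  N%:Z = \sum_(d <- l | P d) mobius d * (c d)%:Z ->
  N%:R = \sum_(d <- l | P d) (mobius d)%:~R * (c d)%:R :> R.
Proof.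
move=> /(congr1 (intr : int -> R)); rewrite /= rmorph_sum -pmulrn => ->.
by apply: eq_bigr => d _; rewrite rmorphM /= -pmulrn.
Qed.

Lemma pi_q_formula (F : finFieldType) (n : nat) (a : {unit F}) : (0 < n)%N ->
  let q := #|F| in
  let S := n%:R^-1 * \sum_(d <- divisors n)
     (mobius d)%:~R * (nroots [set: {unit F}] d a)%:R
     * ((q%:R ^+ (n %/ d) - 1) / (q%:R - 1)) : R in
  (pi_q n ((-1) ^+ n * FinRing.uval a))%:R = S /\
  exists eps : R, 0 <= eps <= 10 /\
    S = (q%:R ^+ n - 1 - eps * q%:R `^ (n%:R / 2)) / (n%:R * (q%:R - 1)).
Proof.
move=> n_gt0 q S; have q_gt1 : (1 < q)%N := finNzRing_gt1 F.
have [E lo hi] := pi_q_sieve a n_gt0.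
set N := pi_q _ _ in E lo hi *.
have n0 : n%:R != 0 :> R by rewrite pnatr_eq0 -lt0n.
have q1_gt0 : 0 < q%:R - 1 :> R by rewrite subr_gt0 ltr1n.
have q1 : q%:R - 1 != 0 :> R by rewrite gt_eqF.
have NS : N%:R = S.
  apply: (mulIf n0); rewrite -natrM (mobius_sum_natr E) mulrC mulVKf //.
  by apply: eq_bigr => d _; rewrite natrM mulrA geom_natr.
split=> //; rewrite -NS; apply: exists_error_term.
- by rewrite powR_gt0 // ltr0n ltnW.
- by rewrite mulf_neq0.
have -> : q%:R ^+ n - 1 - N%:R * (n%:R * (q%:R - 1))
    = ((geom q n)%:R - (N * n)%:R) * (q%:R - 1) :> R.
  by rewrite geom_natr // natrM; field.
apply/andP; split; first by rewrite mulr_ge0 ?(ltW q1_gt0) // subr_ge0 ler_nat.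
apply: le_trans (_ : (\sum_(p <- primes n)
    (nroots [set: {unit F}] p a * geom q (n %/ p))%N)%:R * (q%:R - 1) <= _).
  by rewrite ler_wpM2r ?(ltW q1_gt0) // lerBlDl -natrD ler_nat.
apply: le_trans (norm_error_bound R q_gt1 n_gt0
  (r := fun p => nroots [set: {unit F}] p a) _ _).
- rewrite natr_sum mulr_suml; apply: ler_sum => p _.
  rewrite natrM geom_natr // -mulrA divfK // ler_wpM2l // gerBl //.
- by move=> p; apply: nroots_le_deg.
- by move=> p; apply: nroots_le_card.
Qed.

Lemma pi_star_formula (F : finFieldType) (n : nat) : (0 < n)%N ->
  let q := #|F| in let eta : R := if odd q then 1 else 0 in
  let S := (2 * n)%:R^-1 * \sum_(d <- divisors n | odd d)
     (mobius d)%:~R * (q%:R ^+ (n %/ d) - eta) : R in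
  (pi_star F (2 * n))%:R = S /\
  exists eps : R, 0 <= eps <= 3 /\
    S = (q%:R ^+ n - eps * q%:R `^ (n%:R / 3)) / (2 * n)%:R.
Proof.
move=> n_gt0 q eta S; have q_gt1 : (1 < q)%N := finNzRing_gt1 F.
have [E lo hi] := pi_star_sieve F n_gt0.
set N := pi_star _ _ in E lo hi *.
have n0 : (2 * n)%:R != 0 :> R by rewrite pnatr_eq0 muln_eq0 -lt0n.
have etaE : eta = (odd q)%:R by rewrite /eta; case: (odd q).
have cR d : (q ^ (n %/ d) - odd q)%:R = q%:R ^+ (n %/ d) - eta :> R.
  rewrite etaE natrB ?natrX //; case: (odd q) => //=.
  by rewrite expn_gt0 ltnW.
have NS : N%:R = S.
  apply: (mulIf n0); rewrite -natrM (mobius_sum_natr E) mulrC mulVKf //.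
  by apply: eq_bigr => d _; rewrite cR.
split=> //; rewrite -NS; apply: exists_error_term.
- by rewrite powR_gt0 // ltr0n ltnW.
- by [].
have lo' : (N * (2 * n))%:R <= q%:R ^+ n - eta :> R.
  by have := cR 1%N; rewrite divn1 => <-; rewrite ler_nat; rewrite divn1 in lo.
have hi' : q%:R ^+ n - eta
    <= (N * (2 * n))%:R + \sum_(p <- primes n | odd p) q%:R ^+ (n %/ p) :> R.
  have := cR 1%N; rewrite divn1 => <-; rewrite divn1 in hi.
  apply: le_trans (_ : (N * (2 * n)
      + \sum_(p <- primes n | odd p) (q ^ (n %/ p) - odd q))%N%:R <= _).
    by rewrite ler_nat.
  rewrite natrD lerD2l natr_sum; apply: ler_sum => p _.
  by rewrite cR gerBl etaE.
have eta_ge0 : 0 <= eta by rewrite etaE.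
rewrite -natrM; apply/andP; split; first by lra.
have := star_error_bound R q_gt1 n_gt0; rewrite -etaE; lra.
Qed.

Lemma pi_dagger_formula (s : nat) (F : finFieldType) (U : {group {unit F}})
    (a : {unit F}) (n : nat) :
  #|F| = (s ^ 2)%N -> #|U| = s.+1 -> a \in U -> odd n ->
  let S := n%:R^-1 * \sum_(d <- divisors n)
     (mobius d)%:~R * (nroots U d a)%:R
     * ((s%:R ^+ (n %/ d) + 1) / (s%:R + 1)) : R in
  (pi_dagger s n (- FinRing.uval a))%:R = S /\
  exists eps : R, 0 <= eps <= 40 /\
    S = (s%:R ^+ n + 1 - eps * s%:R `^ (n%:R / 3)) / (n%:R * (s%:R + 1)).
Proof.
move=> Dq cardU Ua odd_n S; have s_gt1 := sqrt_card_gt1 Dq.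
have n_gt0 := odd_gt0 odd_n.
have [E lo hi] := pi_dagger_sieve Dq cardU odd_n Ua.
set N := pi_dagger _ _ _ in E lo hi *.
have n0 : n%:R != 0 :> R by rewrite pnatr_eq0 -lt0n.
have s1_gt0 : 0 < s%:R + 1 :> R by rewrite natr1 ltr0n.
have s1 : s%:R + 1 != 0 :> R by rewrite gt_eqF.
have odd_div d : (d %| n)%N -> odd (n %/ d).
  by move=> dn; apply: dvdn_odd (dvdn_div dn) odd_n.
have NS : N%:R = S.
  apply: (mulIf n0); rewrite -natrM (mobius_sum_natr E) mulrC mulVKf //.
  rewrite !big_seq; apply: eq_bigr => d; rewrite -dvdn_divisors // => dn.
  by rewrite natrM mulrA odd_power_quotient_natr ?odd_div.
split=> //; rewrite -NS; apply: exists_error_term.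
- by rewrite powR_gt0 // ltr0n ltnW.
- by rewrite mulf_neq0.
rewrite nroots1 // mul1n divn1 in lo hi.
have -> : s%:R ^+ n + 1 - N%:R * (n%:R * (s%:R + 1))
    = (((s ^ n).+1 %/ s.+1)%:R - (N * n)%:R) * (s%:R + 1) :> R.
  by rewrite odd_power_quotient_natr // natrM; field.
apply/andP; split; first by rewrite mulr_ge0 ?(ltW s1_gt0) // subr_ge0 ler_nat.
apply: le_trans (_ : (\sum_(p <- primes n)
    (nroots U p a * ((s ^ (n %/ p)).+1 %/ s.+1))%N)%:R * (s%:R + 1) <= _).
  by rewrite ler_wpM2r ?(ltW s1_gt0) // lerBlDl -natrD ler_nat.
apply: le_trans (unitary_error_bound R s_gt1 odd_n
  (r := fun p => nroots U p a) _).
  rewrite natr_sum mulr_suml big_seq [leRHS]big_seq; apply: ler_sum => p.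
  rewrite mem_primes => /and3P[_ _ pn].
  by rewrite natrM odd_power_quotient_natr ?odd_div // -mulrA divfK.
by move=> p; apply: nroots_le_deg.
Qed.

End Formulas.

Theorem proposition2p1 (R : realType) :
  (forall (q : nat) (F : finFieldType) (n : nat) (a : {unit F}),
      #|F| = q -> (1 <= n)%N ->
      (pi_q n ((-1) ^+ n * FinRing.uval a))%:R
        = n%:R^-1 * \sum_(d <- divisors n)
            (mobius d)%:~R * (nroots [set: {unit F}] d a)%:R
            * ((q%:R ^+ (n %/ d) - 1) / (q%:R - 1)) :> R
      /\ exists eps : R, 0 <= eps <= 10 /\
          n%:R^-1 * \sum_(d <- divisors n)
            (mobius d)%:~R * (nroots [set: {unit F}] d a)%:R
            * ((q%:R ^+ (n %/ d) - 1) / (q%:R - 1))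
        = (q%:R ^+ n - 1 - eps * q%:R `^ (n%:R / 2)) / (n%:R * (q%:R - 1)))
  /\
  (forall (q : nat) (F : finFieldType), #|F| = q ->
      (forall f : {poly F}, f \is monic -> irreducible_poly f ->
         star_symmetric f -> f != 'X - 1 -> f != 'X + 1 ->
         ~~ odd (size f).-1 /\ f`_0 = 1)
      /\
      (forall n : nat, (1 <= n)%N ->
         let eta : R := if odd q then 1 else 0 in
         (pi_star F (2 * n))%:R
           = (2 * n)%:R^-1 * \sum_(d <- divisors n | odd d)
               (mobius d)%:~R * (q%:R ^+ (n %/ d) - eta) :> R
         /\ exists eps : R, 0 <= eps <= 3 /\
             (2 * n)%:R^-1 * \sum_(d <- divisors n | odd d)
               (mobius d)%:~R * (q%:R ^+ (n %/ d) - eta)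
           = (q%:R ^+ n - eps * q%:R `^ (n%:R / 3)) / (2 * n)%:R))
  /\
  (forall (q s : nat) (F : finFieldType) (U : {group {unit F}}),
      #|F| = q -> q = (s ^ 2)%N -> cyclic U -> #|U| = s.+1 ->
      (forall f : {poly F}, f \is monic -> irreducible_poly f ->
         dagger_symmetric s f ->
         odd (size f).-1 /\ exists2 u, u \in U & f`_0 = FinRing.uval u)
      /\
      (forall (a : {unit F}) (n : nat), a \in U -> (1 <= n)%N ->
         (pi_dagger s (2 * n - 1) (- FinRing.uval a))%:R
           = (2 * n - 1)%:R^-1 * \sum_(d <- divisors (2 * n - 1))
               (mobius d)%:~R * (nroots U d a)%:R
               * ((q%:R `^ ((n%:R - 2^-1) / d%:R) + 1) / (q%:R `^ 2^-1 + 1))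
             :> R
         /\ exists eps : R, 0 <= eps <= 40 /\
             (2 * n - 1)%:R^-1 * \sum_(d <- divisors (2 * n - 1))
               (mobius d)%:~R * (nroots U d a)%:R
               * ((q%:R `^ ((n%:R - 2^-1) / d%:R) + 1) / (q%:R `^ 2^-1 + 1))
           = (q%:R `^ (n%:R - 2^-1) + 1
                - eps * q%:R `^ (n%:R / 3 - 6^-1))
             / ((2 * n - 1)%:R * (q%:R `^ 2^-1 + 1)))).
Proof.
split; first by move=> q F n a <- n_gt0; apply: pi_q_formula.
split.
  move=> q F <-; split=> [f fmon firr | n n_gt0]; first exact: star_symmetric_even.
  exact: pi_star_formula.
move=> q s F U Dq Dqs _ cardU; have DF : #|F| = (s ^ 2)%N by rewrite Dq.
split=> [f fmon firr fs | a n Ua n_gt0].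
  have [odd_f f0] := dagger_symmetric_odd fmon firr DF fs; split=> //.
  have f0_neq0 : f`_0 != 0 by case/andP: fs.
  exists (finField_unit f0_neq0) => //.
  by rewrite (unitary_groupE DF cardU) /= f0.
set m := (2 * n - 1)%N; have odd_m : odd m by rewrite oddB ?oddM //; lia.
have powq (x y : R) : y = 2 * x -> q%:R `^ x = s%:R `^ y.
  by move=> ->; rewrite Dqs natrX -powR_mulrn // -powRrM.
have mE : m%:R = 2 * n%:R - 1 :> R by rewrite natrB ?natrM //; lia.
have -> : q%:R `^ 2^-1 = s%:R :> R.
  by rewrite (powq _ 1) ?powRr1 ?ler0n //; field.
have -> : q%:R `^ (n%:R - 2^-1) = s%:R ^+ m :> R.
  by rewrite (powq _ m%:R) ?powR_mulrn // mE; field.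
have -> : q%:R `^ (n%:R / 3 - 6^-1) = s%:R `^ (m%:R / 3) :> R.
  by apply: powq; rewrite mE; field.
have termE d : d \in divisors m ->
    q%:R `^ ((n%:R - 2^-1) / d%:R) = s%:R ^+ (m %/ d) :> R.
  rewrite -dvdn_divisors ?odd_gt0 // => dm.
  have d0 : d%:R != 0 :> R by rewrite pnatr_eq0 -lt0n (dvdn_gt0 (odd_gt0 odd_m)).
  rewrite (powq _ (m %/ d)%:R) ?powR_mulrn //; apply: (mulIf d0).
  by rewrite -natrM divnK // mE; field.
have -> : \sum_(d <- divisors m) (mobius d)%:~R * (nroots U d a)%:R
      * ((q%:R `^ ((n%:R - 2^-1) / d%:R) + 1) / (s%:R + 1))
    = \sum_(d <- divisors m) (mobius d)%:~R * (nroots U d a)%:R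
      * ((s%:R ^+ (m %/ d) + 1) / (s%:R + 1)) :> R.
  by rewrite !big_seq; apply: eq_bigr => d dm; rewrite termE.
exact: pi_dagger_formula.
Qed.
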